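(* Every conformal map $f:(\mathbb{R}^2,D)\to(\mathbb{R}^2,D)$ is the boundary map of an isometry $G_A\to G_A$.
   Context: Let $A=\begin{pmatrix}1&1\\0&1\end{pmatrix}$. $G_A=\mathbb{R}^2\rtimes_A\mathbb{R}$ is the Lie group $\mathbb{R}^2\times\mathbb{R}$ with operation $(v,t)\cdot(w,s)=(v+e^{tA}w,\,t+s)$, endowed with the left invariant Riemannian metric that is the standard Euclidean metric of $\mathbb{R}^3$ at the identity; it has pinched negative sectional curvature, so it has an ideal boundary $\partial G_A$. For $v\in\mathbb{R}^2$ the map $\gamma_v(t)=(v,t)$ is a geodesic (a vertical geodesic); all $\gamma_v$ are asymptotic as $t\to+\infty$ and define a point $\xi_0\in\partial G_A$. The set $\partial G_A\setminus\{\xi_0\}$ is identified with $\mathbb{R}^2$, $v\in\mathbb{R}^2$ corresponding to the endpoint of $\gamma_v(t)$ as $t\to-\infty$. An isometry of $G_A$ induces a homeomorphism of $\partial G_A$; a map $f:\mathbb{R}^2\to\mathbb{R}^2$ is the boundary map of an isometry if the induced homeomorphism fixes $\xi_0$ and restricts to $f$ on $\partial G_A\setminus\{\xi_0\}=\mathbb{R}^2$. $D$ is the quasimetric on $\mathbb{R}^2$ given by $D((x_1,y_1),(x_2,y_2))=\max\{|y_2-y_1|,\ |(x_2-x_1)-(y_2-y_1)\ln|y_2-y_1||\}$, with $0\ln0=0$. A bijection $F:X\to Y$ between quasimetric spaces is quasisymmetric if there is a homeomorphism $\eta:[0,\infty)\to[0,\infty)$ such that for all distinct triples $x,y,z\in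 X$, $\frac{d(F(x),F(y))}{d(F(x),F(z))}\le\eta\left(\frac{d(x,y)}{d(x,z)}\right)$. For a quasisymmetric $g:(X_1,\rho_1)\to(X_2,\rho_2)$, $x\in X_1$, $r>0$, put $L_g(x,r)=\sup\{\rho_2(g(x),g(x')):\rho_1(x,x')\le r\}$, $l_g(x,r)=\inf\{\rho_2(g(x),g(x')):\rho_1(x,x')\ge r\}$, $L_g(x)=\limsup_{r\to0}L_g(x,r)/r$, $l_g(x)=\liminf_{r\to0}l_g(x,r)/r$. Let $X,Y$ be quasimetric spaces of finite Hausdorff dimension, with $\mathcal{H}_X,\mathcal{H}_Y$ their Hausdorff measures (in their respective Hausdorff dimensions). A quasisymmetric map $f:X\to Y$ is conformal if (1) $L_f(x)=l_f(x)\in(0,\infty)$ for $\mathcal{H}_X$-almost every $x\in X$, and (2) $L_{f^{-1}}(y)=l_{f^{-1}}(y)\in(0,\infty)$ for $\mathcal{H}_Y$-almost every $y\in Y$. *)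

(* Defs.v *)
From mathcomp Require Import all_boot all_order all_algebra.
From mathcomp Require Import all_classical all_reals all_analysis.

Set Implicit Arguments.
Unset Strict Implicit.
Unset Printing Implicit Defensive.

Import Order.TTheory GRing.Theory Num.Theory.
Import numFieldNormedType.Exports.

Local Open Scope classical_set_scope.
Local Open Scope ring_scope.

Section Hausdorff.
Context {R : realType} {T : Type} (d : T -> T -> R).

Definition diam (U : set T) : \bar R :=
  ereal_sup [set (d x.1 x.2)%:E | x in U `*` U].

(* The empty set is given size 0 explicitly, since [diam set0 = -oo] and
   [poweR x 0 = 1]. *)
Definition hausdorff_gauge (s : R) (U : set T) : \bar R :=
  if U == set0 then 0%E else poweR (diam U) s.

Definition hausdorff_premeasure (s delta : R) (E : set T) : \bar R :=
  ereal_inf [set (\sum_(0 <= k <oo) hausdorff_gauge s (U k))%E |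
    U in [set U : nat -> set T |
      E `<=` \bigcup_k U k /\ forall k, (diam (U k) <= delta%:E)%E]].

Definition hausdorff_measure (s : R) (E : set T) : \bar R :=
  ereal_sup [set hausdorff_premeasure s delta E | delta in [set x | 0 < x]].

Definition hausdorff_dim : \bar R :=
  ereal_inf [set s%:E | s in
    [set s : R | 0 <= s /\ hausdorff_measure s [set: T] = 0%E]].

(* Only meaningful when [hausdorff_dim] is finite. *)
Definition hausdorff_ae (P : T -> Prop) : Prop :=
  hausdorff_measure (fine hausdorff_dim) [set x | ~ P x] = 0%E.

End Hausdorff.

Section Quasisymmetric.
Context {R : realType}.

Definition halfline_homeo (eta : R -> R) : Prop :=
  exists zeta : R -> R,
    [/\ forall t, 0 <= t -> 0 <= eta t /\ zeta (eta t) = t,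
        forall t, 0 <= t -> 0 <= zeta t /\ eta (zeta t) = t,
        {within `[0, +oo[, continuous eta} &
        {within `[0, +oo[, continuous zeta}].

Context {X Y : Type}.

Definition quasisymmetric (dX : X -> X -> R) (dY : Y -> Y -> R)
    (F : X -> Y) : Prop :=
  bijective F /\
  exists2 eta : R -> R, halfline_homeo eta &
    forall x y z, x <> y -> y <> z -> x <> z ->
      dY (F x) (F y) / dY (F x) (F z) <= eta (dX x y / dX x z).

End Quasisymmetric.

Section Conformal.
Context {R : realType}.

Section Dilatation.
Context {X Y : Type} (dX : X -> X -> R) (dY : Y -> Y -> R) (g : X -> Y).

Definition upper_dist (x : X) (r : R) : \bar R :=
  ereal_sup [set (dY (g x) (g x'))%:E | x' in [set x' | dX x x' <= r]].

Definition lower_dist (x : X) (r : R) : \bar R :=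
  ereal_inf [set (dY (g x) (g x'))%:E | x' in [set x' | r <= dX x x']].

Definition upper_dilatation (x : X) : \bar R :=
  limf_esup (fun r => upper_dist x r * (r^-1)%:E)%E 0^'+.

Definition lower_dilatation (x : X) : \bar R :=
  limf_einf (fun r => lower_dist x r * (r^-1)%:E)%E 0^'+.

Definition conformal_at (x : X) : Prop :=
  [/\ upper_dilatation x = lower_dilatation x,
      (0 < upper_dilatation x)%E & (upper_dilatation x < +oo)%E].

End Dilatation.

Definition conformal {X Y : Type} (dX : X -> X -> R) (dY : Y -> Y -> R)
    (f : X -> Y) : Prop :=
  exists finv : Y -> X,
    [/\ cancel f finv, cancel finv f,
        quasisymmetric dX dY f,
        hausdorff_ae dX (conformal_at dX dY f) &
        hausdorff_ae dY (conformal_at dY dX finv)].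

End Conformal.

Definition expmx {R : realType} {n : nat} (M : 'M[R]_n.+1) : 'M[R]_n.+1 :=
  limn (series (fun k => (k`!%:R)^-1 *: M ^+ k)).

Section GroupGA.
Context {R : realType}.

Definition matA : 'M[R]_2 := \matrix_(i, j) (i <= j)%N%:R.

Local Notation G := ('cV[R]_2 * R)%type.

Definition gmul (p q : G) : G :=
  (p.1 + expmx (p.2 *: matA) *m q.1, p.2 + q.2).

Definition ginv (p : G) : G :=
  (- (expmx ((- p.2) *: matA) *m p.1), - p.2).

Definition euclid_dot (X Y : G) : R :=
  (\sum_i X.1 i 0 * Y.1 i 0) + X.2 * Y.2.

(* Tangent vectors at [p] are identified with elements of R^2 x R; they are
   carried to the identity by the differential of left translation by
   [ginv p]. The norm of the library on R^2 x R is the sup norm, hence the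
   explicit inner product. *)
Definition gmetric (p X Y : G) : R :=
  euclid_dot ('D_X (gmul (ginv p)) p) ('D_Y (gmul (ginv p)) p).

Definition C1_curve (c : R -> G) : Prop :=
  (forall t, derivable c t 1) /\ continuous (derive1 c).

Definition curve_length (c : R -> G) : R :=
  \int[lebesgue_measure]_(t in `[0, 1])
    Num.sqrt (gmetric (c t) (derive1 c t) (derive1 c t)).

Definition gdist (p q : G) : R :=
  inf [set curve_length c | c in
    [set c : R -> G | [/\ C1_curve c, c 0 = p & c 1 = q]]].

Definition is_isometry (phi : G -> G) : Prop :=
  bijective phi /\ forall p q, gdist (phi p) (phi q) = gdist p q.

(* Rays are total functions on R; only their values on [0, +oo) matter. *)
Definition geodesic_ray (c : R -> G) : Prop :=
  forall s t, 0 <= s -> 0 <= t -> gdist (c s) (c t) = `|s - t|.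

Definition asymptotic (c1 c2 : R -> G) : Prop :=
  exists C : R, forall t, 0 <= t -> gdist (c1 t) (c2 t) <= C.

Definition endpoint (c : R -> G) : set (R -> G) :=
  [set c' | geodesic_ray c' /\ asymptotic c c'].

(* A point at infinity is an asymptote class of geodesic rays. *)
Definition ideal_boundary : set (set (R -> G)) :=
  [set endpoint c | c in geodesic_ray].

Definition vertical (v : 'cV[R]_2) : R -> G := fun t => (v, t).

Definition xi0 : set (R -> G) := endpoint (vertical 0).

Definition boundary_point (v : 'cV[R]_2) : set (R -> G) :=
  endpoint (fun t => vertical v (- t)).

Definition induced_boundary_map (phi : G -> G) (xi : set (R -> G)) :
    set (R -> G) :=
  [set phi \o c | c in xi].

Definition boundary_map_of (phi : G -> G) (f : 'cV[R]_2 -> 'cV[R]_2) : Prop :=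
  induced_boundary_map phi xi0 = xi0 /\
  forall v, induced_boundary_map phi (boundary_point v) = boundary_point (f v).

(* The convention 0 ln 0 = 0 holds by the product with [`|dy| = 0]. *)
Definition quasimetricD (p q : 'cV[R]_2) : R :=
  let dx := q 0 0 - p 0 0 in
  let dy := q 1 0 - p 1 0 in
  Num.max `|dy| `|dx - dy * ln `|dy| |.

End GroupGA.

(* Main.v *)
(* For points at distance at most m, D is comparable to the sup norm of
   (dy, dx - dy ln m), because |t ln|t| - t ln m| <= m when |t| <= m.

   A quasisymmetric f maps horizontal lines to horizontal lines. By a
   length-area estimate most horizontal segments have images that are chains of
   O(1/tau) steps of size at most tau; such a chain moving vertically by Y moves
   horizontally by Y ln tau + O(1), which is unbounded as tau -> 0 unless Y = 0.

   So f(x, y) = (g(x, y), u(y)). Points of two horizontal lines that realize the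
   distance between them are mapped to comparably close points, so going from
   height y - Y to y in N equal steps gives, uniformly in N,
   g(z - Y ln N, y) - g(z, y) = - (u(y) - u(y - Y)) ln N + O(Y).
   Hence (u(y) - u(y - Y)) / Y does not depend on Y, and letting Y -> 0, g is
   affine in x with this slope: f(x, y) = (a x + C(y), a y + b), where
   h(y) = C(y) - a ln|a| y is Lipschitz.

   At a conformal point h' = 0. The exceptional heights form a Lebesgue-null set
   because dim (R^2, D) <= 2, so h is constant and f(v) = sgn(a) e^(tA) v + w with
   t = ln|a|, the boundary map of (v, s) |-> (sgn(a) e^(tA) v + w, s + t). *)

Require Import Defs.
From mathcomp Require Import all_boot all_order all_algebra.
From mathcomp Require Import all_classical all_reals all_analysis.
From mathcomp Require Import measurable_realfun ring lra.

Set Implicit Arguments.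
Unset Strict Implicit.
Unset Printing Implicit Defensive.

Import Order.TTheory GRing.Theory Num.Theory.
Import numFieldNormedType.Exports.

Local Open Scope classical_set_scope.
Local Open Scope ring_scope.

(** * The quasimetric and its chains *)

Section Quasimetric.
Context {R : realType}.
Implicit Types (p q z : 'cV[R]_2) (x y t m : R).

(** The rigidity comes from the failure of [D] to be additive. Climbing a height [Y] by one
    closest-point step shifts [x] by [Y ln Y], by [N] equal steps it shifts [x] by [Y ln (Y / N)].
    The discrepancy is unbounded in [N], while each step of the image chain errs by only [O(Y / N)].
    Reproducing it forces the slope along horizontal lines, without any differentiability theorem.
    The inverse map matters as well: it too preserves horizontal lines, so distinct lines have
    distinct images, and the point of an image line closest to a given image point has its preimage
    on the expected line. This makes vertical and horizontal increments comparable in both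
    directions. One conformal point on a horizontal line is enough for that height, so a height is
    exceptional only if its whole line is. Such heights are controlled by covers with small sum of
    squared radii, which avoids measurability and Fubini. In [G_A] the distance is an infimum of
    lengths of C1 curves, and comparing asymptote classes requires its triangle inequality; hence
    the concatenation of curves at the end. *)

Definition vec x y : 'cV[R]_2 := \col_i (if i == 0 then x else y).
(** The horizontal offset, at height difference [t], for which the second term of [D] vanishes. *)
Definition xlnx t : R := t * ln `|t|.

Lemma vec0 x y : vec x y 0 0 = x. Proof. by rewrite mxE. Qed.
Lemma vec1 x y : vec x y 1 0 = y. Proof. by rewrite mxE. Qed.
Definition vecE := (vec0, vec1).

Lemma vecP p q : p 0 0 = q 0 0 -> p 1 0 = q 1 0 -> p = q.
Proof.
move=> h0 h1; apply/colP => i.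
have : i = 0 \/ i = 1.
  by case: i => [[|[|//]] ?]; [left|right]; apply/val_inj.
by case=> ->.
Qed.

Lemma vec_eta p : vec (p 0 0) (p 1 0) = p.
Proof. by apply: vecP; rewrite vecE. Qed.

(** The difference is [- t ln (m / |t|)], and [ln u < u] at [u = m / |t|] bounds it by [m]. *)
Lemma xlnx_approx t m : `|t| <= m -> `|xlnx t - t * ln m| <= m.
Proof.
move=> tm; have [->|t0] := eqVneq t 0.
  by rewrite /xlnx !mul0r subrr normr0 (le_trans _ tm).
have nt0 : 0 < `|t| by rewrite normr_gt0.
have m0 : 0 < m by apply: lt_le_trans tm.
rewrite /xlnx -mulrBr normrM distrC [X in _ * X]ger0_norm; last first.
  by rewrite subr_ge0 ler_ln // posrE.
rewrite -ln_div ?posrE // mulrC -ler_pdivlMr //.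
by apply/ltW/ln_sublinear; rewrite divr_gt0.
Qed.

Lemma xlnx0 : xlnx 0 = 0. Proof. by rewrite /xlnx mul0r. Qed.

Lemma xlnxN t : xlnx (- t) = - xlnx t.
Proof. by rewrite /xlnx normrN mulNr. Qed.

(** A dilation by [a] respects the curve [x = xlnx y] only up to the linear term [a t ln|a|]. This
    term is the shear that [e^(tA)] adds to a dilation, for [t = ln|a|]. *)
Lemma xlnxM a t : a != 0 -> t != 0 ->
  xlnx (a * t) = a * xlnx t + a * t * ln `|a|.
Proof.
by move=> a0 t0; rewrite /xlnx normrM lnM ?posrE ?normr_gt0 //; ring.
Qed.

Local Notation D := quasimetricD.

Lemma quasiD_le p q m : (D p q <= m) =
  (`|q 1 0 - p 1 0| <= m) &&
  (`|q 0 0 - p 0 0 - xlnx (q 1 0 - p 1 0)| <= m).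
Proof. by rewrite /D ge_max. Qed.

Lemma quasiD_ge0 p q : 0 <= D p q.
Proof. by rewrite /D le_max normr_ge0. Qed.

Lemma quasiD_dy p q : `|q 1 0 - p 1 0| <= D p q.
Proof. by rewrite /D le_max lexx. Qed.

Lemma quasiD_dx p q : `|q 0 0 - p 0 0 - xlnx (q 1 0 - p 1 0)| <= D p q.
Proof. by rewrite /D le_max lexx orbT. Qed.

Lemma quasiDC p q : D p q = D q p.
Proof.
rewrite /D -!/(xlnx _) -(opprB (q 1 0)) normrN; congr Num.max.
by rewrite -normrN xlnxN; congr `|_|; ring.
Qed.

Lemma quasiDxx p : D p p = 0.
Proof. by rewrite /D !subrr mul0r subrr normr0 maxxx. Qed.

Lemma quasiD_eq0 p q : D p q <= 0 -> p = q.
Proof.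
rewrite quasiD_le !normr_le0 => /andP[/eqP y0]; rewrite y0 xlnx0 subr0.
by rewrite subr_eq0 => /eqP x0; apply: vecP => //; apply/esym/subr0_eq.
Qed.

Lemma quasiD_gt0 p q : (0 < D p q) = (p != q).
Proof.
apply/idP/idP => [|pq]; first by apply: contraTneq => ->; rewrite quasiDxx ltxx.
by rewrite ltNge; apply: contra_neqN pq; exact: quasiD_eq0.
Qed.

Lemma quasiD_horizontal p q : p 1 0 = q 1 0 -> D p q = `|q 0 0 - p 0 0|.
Proof.
move=> pq; rewrite /D -!/(xlnx _) pq subrr xlnx0 normr0 subr0.
by apply/max_idPr.
Qed.

Lemma quasiD_matched x y t : D (vec x y) (vec (x + xlnx t) (y + t)) = `|t|.
Proof.
have e u v : u + v - u = v :> R by ring.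
rewrite /D !vecE !e; apply/max_idPl.
by rewrite /xlnx subrr normr0.
Qed.

(** All three logarithmic terms are compared with the same linear function, of slope [ln (2 m)]. The
    three comparisons cost [2 m] each and the two hypotheses [m] each, hence the constant 8. *)
Lemma quasiD_tri q p z m : D p q <= m -> D q z <= m -> D p z <= 8 * m.
Proof.
rewrite !quasiD_le => /andP[y1 x1] /andP[y2 x2].
have m0 : 0 <= m by exact: le_trans y1.
set s := q 1 0 - p 1 0 in y1 x1; set t := z 1 0 - q 1 0 in y2 x2.
have -> : z 1 0 - p 1 0 = s + t by rewrite /s /t; ring.
have st : `|s + t| <= 2 * m by rewrite (le_trans (ler_normD _ _)) //; lra.
have /xlnx_approx a1 : `|s| <= 2 * m by lra.
have /xlnx_approx a2 : `|t| <= 2 * m by lra.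
have a3 := xlnx_approx st.
apply/andP; split; first lra.
move: x1 x2 a1 a2 a3; rewrite [(s + t) * _]mulrDl !ler_norml; lra.
Qed.

Lemma quasiD_dx_bound p q m : 0 < m -> D p q <= m ->
  `|q 0 0 - p 0 0| <= m * (2 + `|ln m|).
Proof.
move=> m0; rewrite quasiD_le => /andP[y1 x1].
have := xlnx_approx y1; set t := _ 1 0 - _ in y1 x1 *.
have : `|t * ln m| <= m * `|ln m| by rewrite normrM ler_wpM2r.
rewrite mulrDr; move: x1; rewrite !ler_norml; lra.
Qed.

(* Unlike [D] itself, the sheared coordinate [x - y ln m] is additive along
   chains of points. *)
Lemma quasiD_shear p q m : D p q <= m ->
  `|(q 0 0 - q 1 0 * ln m) - (p 0 0 - p 1 0 * ln m)| <= 2 * m.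
Proof.
rewrite quasiD_le => /andP[y1 x1]; have := xlnx_approx y1.
set X := xlnx _ in x1 *; move: x1; rewrite mulrBl !ler_norml; lra.
Qed.

End Quasimetric.

(** * Overlap estimates for finite families of intervals *)

Section Intervals.
Context {R : realType} {I : finType}.
Implicit Types (a b w : I -> R) (A B C : R).
Local Notation mu := (@lebesgue_measure R).

Let indicator_itv (a b : R) :
  (fun x : R => (a <= x <= b)%R%:R) = \1_(`[a, b]%classic) :> (R -> R).
Proof. by apply/funext => x; rewrite indicE mem_setE in_itv. Qed.

Let measurable_weighted_itv a b w D :
  measurable_fun D (fun x => \sum_i w i * (a i <= x <= b i)%R%:R).
Proof.
apply: measurable_sum => i; apply: measurable_funM => //.
rewrite indicator_itv; exact: measurable_indic.
Qed.

Lemma integral_weighted_itv a b w A B : (forall i, 0 <= w i) ->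
  (\int[mu]_(x in `[A, B]) (\sum_i w i * (a i <= x <= b i)%R%:R)%:E =
  \sum_i (w i)%:E * mu (`[a i, b i]%classic `&` `[A, B]%classic))%E.
Proof.
move=> w0; under eq_integral do rewrite -sumEFin.
rewrite ge0_integral_sum //=; last 2 first.
- move=> i; apply/measurable_EFinP; apply: measurable_funM => //.
  rewrite indicator_itv; exact: measurable_indic.
- by move=> i x _; rewrite lee_fin mulr_ge0.
apply: eq_bigr => i _.
under eq_integral do rewrite EFinM.
rewrite ge0_integralZl_EFin //; last first.
  apply/measurable_EFinP; rewrite indicator_itv; exact: measurable_indic.
rewrite -integral_indic //; congr (_ * _)%E; apply: eq_integral => x _.
by rewrite -indicator_itv.
Qed.

Let lebesgue_itv (A B : R) : A <= B -> mu `[A, B]%classic = (B - A)%:E.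
Proof.
move=> AB; rewrite lebesgue_measure_itv/= lte_fin.
by case: ltgtP AB => // ->; rewrite subrr.
Qed.

Let integral_cst_itv A B C : A <= B ->
  (C * (B - A))%:E = (\int[mu]_(x in `[A, B]) (C%:E))%E.
Proof.
by move=> AB; have /= -> := integral_cst mu (measurable_itv `[A, B]) C%:E;
rewrite lebesgue_itv.
Qed.

(** Integrate the step function over [[A, B]]. The intervals are constrained only where the weight
    is nonzero, so that weights 0 and 1 can select a subfamily. *)
Lemma weighted_itv_le a b w A B C : A <= B -> 0 <= C -> (forall i, 0 <= w i) ->
  (forall i, w i != 0 -> [/\ a i <= b i, A <= a i & b i <= B]) ->
  (forall x, \sum_i w i * (a i <= x <= b i)%R%:R <= C) ->
  \sum_i w i * (b i - a i) <= C * (B - A).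
Proof.
move=> AB C0 w0 abAB le.
have := integral_weighted_itv a b A B w0.
rewrite [RHS](_ : _ = (\sum_i w i * (b i - a i))%:E); last first.
  rewrite -sumEFin; apply: eq_bigr => i _; rewrite EFinM.
  have [->|/abAB[abi Aa bB]] := eqVneq (w i) 0; first by rewrite !mul0e.
  congr (_ * _)%E.
  rewrite (@setIidl _ `[a i, b i]%classic); first exact: lebesgue_itv.
  by move=> x /=; rewrite !in_itv /= => /andP[? ?]; apply/andP; split; lra.
move=> e; rewrite -lee_fin -e integral_cst_itv //.
apply: ge0_le_integral => //=.
- by move=> x _; rewrite lee_fin sumr_ge0 // => i _; rewrite mulr_ge0.
- by apply/measurable_EFinP; exact: measurable_weighted_itv.
- by move=> x _; rewrite lee_fin.
Qed.

Lemma weighted_itv_ge a b w A B C : A <= B -> 0 <= C -> (forall i, 0 <= w i) ->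
  (forall i, a i <= b i) ->
  (forall x, A <= x <= B -> C <= \sum_i w i * (a i <= x <= b i)%R%:R) ->
  C * (B - A) <= \sum_i w i * (b i - a i).
Proof.
move=> AB C0 w0 ab ge.
rewrite -lee_fin integral_cst_itv //.
apply: (@le_trans _ _ (\sum_i (w i)%:E * mu (`[a i, b i]%classic `&` `[A,
  B]%classic))%E).
  rewrite -integral_weighted_itv //; apply: ge0_le_integral => //=.
  by apply/measurable_EFinP; exact: measurable_weighted_itv.
rewrite -sumEFin; apply: lee_sum => i _; rewrite EFinM lee_wpmul2l ?lee_fin //.
by rewrite -lebesgue_itv //; apply: le_measure; rewrite ?inE //;
  exact: measurableI.
Qed.

End Intervals.

(** * Division-free moduli of quasisymmetries *)

Section Control.
Context {R : realType}.
Implicit Types (f : 'cV[R]_2 -> 'cV[R]_2) (p q z : 'cV[R]_2).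
Local Notation D := quasimetricD.

(* The two moduli of a quasisymmetry, in a division-free form that is
   self-dual: each modulus of the inverse comes from the other one of [f]. *)
Definition qs_control f : Prop :=
  (forall T : R, exists2 B : R, 0 < B & forall p q z, D p q <= T * D p z ->
     D (f p) (f q) <= B * D (f p) (f z)) /\
  (forall e : R, 0 < e -> exists2 c : R, 0 < c & forall p q z,
    D p q <= c * D p z ->
     D (f p) (f q) <= e * D (f p) (f z)).

(** A continuous injection is strictly monotone, and [eta] cannot decrease because the value
    [eta 0 + 1] is attained. Its minimum [eta 0] is then the attained value 0. *)
Lemma halfline_homeo_incr (eta : R -> R) : halfline_homeo eta ->
  eta 0 = 0 /\ (forall s t, 0 <= s -> s <= t -> eta s <= eta t).
Proof.
move=> [zeta [ez ze ce _]].
have I (t : R) : 0 <= t -> t \in `[0, +oo[ by move=> t0; rewrite in_itv/= t0.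
have I' (t : R) : t \in `[0, +oo[ -> 0 <= t by rewrite in_itv/= andbT.
have inj : {in `[0, +oo[ &, injective eta}.
  by move=> s t /I' s0 /I' t0 st; rewrite -(ez s s0).2 st (ez t t0).2.
have e0 := (ez 0 (lexx 0)).1.
have [incr|decr] := itv_continuous_inj_mono ce inj; last first.
  have [z0 zE] := ze (eta 0 + 1) (addr_ge0 e0 ler01).
  move: (z0); rewrite le_eqVlt => /predU1P[zz|zpos].
    by move: zE; rewrite -zz; lra.
  have := decr _ _ (I _ z0) (I _ (lexx 0)) zpos.
  by rewrite zE; lra.
have mono s t : 0 <= s -> s <= t -> eta s <= eta t.
  move=> s0; rewrite le_eqVlt => /predU1P[->//|st].
  by apply/ltW/incr => //; apply: I => //; lra.
split=> //; have [z0 zE] := ze 0 (lexx 0).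
by apply/le_anti; rewrite e0 andbT -{2}zE mono.
Qed.

Lemma quasisymmetric_control f : quasisymmetric D D f -> qs_control f.
Proof.
move=> [/bij_inj finj [eta heta qs]].
have [eta0 mono] := halfline_homeo_incr heta.
have Dg0 p q : p <> q -> 0 < D p q by move=> /eqP pq; rewrite quasiD_gt0.
have ratio_le p q z t : 0 <= t -> p <> q -> q <> z -> p <> z ->
  D p q <= t * D p z ->
    D (f p) (f q) <= eta t * D (f p) (f z).
  move=> t0 pq qz pz pqz.
  have fz : 0 < D (f p) (f z) by apply: Dg0 => /finj.
  rewrite -ler_pdivrMr //; apply: (le_trans (qs _ _ _ pq qz pz)).
  by apply: mono; rewrite ?divr_ge0 ?quasiD_ge0 // ler_pdivrMr // Dg0.
split=> [T|e e0].
- have E0 : 0 <= eta (Num.max T 0) by rewrite -{1}eta0 mono // le_max lexx orbT.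
  (* The added 1 makes the modulus at least 1, which settles the case [q = z] left out by the
     quasisymmetry inequality. *)
  exists (eta (Num.max T 0) + 1); first lra.
  move=> p q z.
  have [<-|/eqP pq] := eqVneq p q; first by rewrite !quasiDxx => _;
    rewrite mulr_ge0 ?quasiD_ge0 //; lra.
  have [<-|/eqP pz] := eqVneq p z.
    by rewrite quasiDxx mulr0 => /quasiD_eq0.
  have [<- _|/eqP qz] := eqVneq q z.
    by rewrite ler_peMl ?quasiD_ge0 //; lra.
  move=> h; apply: (@le_trans _ _ (eta (Num.max T 0) * D (f p) (f z))).
    apply: ratio_le => //; first by rewrite le_max lexx orbT.
    by apply: (le_trans h); rewrite ler_wpM2r ?quasiD_ge0 // le_max lexx.
  by rewrite ler_wpM2r ?quasiD_ge0 //; lra.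
- have [zeta [ez ze _ _]] := heta; have [ze0 zeE] := ze e (ltW e0).
  have ze1 : 0 < zeta e.
    rewrite lt_neqAle ze0 andbT; apply: contraTneq e0 => zz.
    by rewrite -zeE -zz eta0 ltxx.
  (* A constant below 1 excludes [q = z] when [p <> q]; that case is not covered by the
     quasisymmetry inequality. *)
  exists (Num.min (2^-1) (zeta e)); first by rewrite lt_min ze1 andbT; lra.
  move=> p q z.
  have [<-|/eqP pq] := eqVneq p q; first by rewrite !quasiDxx => _;
    rewrite mulr_ge0 ?quasiD_ge0 //; lra.
  have [<-|/eqP pz] := eqVneq p z.
    by rewrite quasiDxx mulr0 => /quasiD_eq0.
  have [<-|/eqP qz] := eqVneq q z.
    have := Dg0 _ _ pq => q0.
    rewrite -{1}[D p q]mul1r ler_pM2r // le_min => /andP[]; lra.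
  move=> h; rewrite -[e in e * _]zeE; apply: ratio_le => //.
  by apply: (le_trans h); rewrite ler_wpM2r ?quasiD_ge0 // ge_min lexx orbT.
Qed.

(** By contraposition: if the bound failed for [g], a modulus of [f] at [g p], with the other two
    points exchanged, would give an inequality that is compatible with the hypothesis only if
    [D p z] or [D p q] vanishes. The constants [(|T| + 1)^-1] and [(B + 1)^-1] produce this
    incompatibility. *)
Lemma qs_control_inv f g : cancel f g -> cancel g f -> qs_control f ->
  qs_control g.
Proof.
move=> fg gf [h1 h2].
have ginj := can_inj gf.
split=> [T|e e0].
- have T1 : 0 < (`|T| + 1)^-1 by rewrite invr_gt0; have := normr_ge0 T; lra.
  have [c c0 hc] := h2 _ T1; exists c^-1; first by rewrite invr_gt0.
  move=> p q z h; rewrite leNgt; apply/negP => lt.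
  have {}lt : D (g p) (g z) < c * D (g p) (g q).
    by rewrite mulrC -ltr_pdivrMr // mulrC.
  have := hc _ _ _ (ltW lt); rewrite !gf => h'.
  have Z : 0 <= D p z by exact: quasiD_ge0.
  have T2 : 0 < `|T| + 1 by have := normr_ge0 T; lra.
  have : D p z * (`|T| + 1) <= D p q by rewrite -ler_pdivlMr // mulrC.
  rewrite mulrDr mulr1 => h''.
  have Tz : T * D p z <= D p z * `|T| by rewrite mulrC ler_wpM2l // ler_norm.
  have pz : p = z by apply: quasiD_eq0; lra.
  move: h; rewrite -pz quasiDxx mulr0 => /quasiD_eq0 pq.
  by move: lt; rewrite -pz -pq quasiDxx mulr0 ltxx.
- have [B B0 hB] := h1 e^-1.
  have B1 : 0 < B + 1 by lra.
  exists (B + 1)^-1; first by rewrite invr_gt0.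
  move=> p q z h; rewrite leNgt; apply/negP => lt.
  have {}lt : D (g p) (g z) < e^-1 * D (g p) (g q).
    by rewrite mulrC ltr_pdivlMr // mulrC.
  have := hB _ _ _ (ltW lt); rewrite !gf => h'.
  have Q : 0 <= D p q by exact: quasiD_ge0.
  have : D p q * (B + 1) <= D p z by rewrite -ler_pdivlMr // mulrC.
  rewrite mulrDr mulr1 [_ * B]mulrC => h''.
  have pq : p = q by apply: quasiD_eq0; lra.
  move: lt; rewrite -pq quasiDxx mulr0.
  by rewrite ltNge quasiD_ge0.
Qed.
End Control.

Section Chain.
Context {R : realType} {I : eqType}.
Implicit Types (lo hi : I -> R).

Lemma closed_itv_gap (s : seq I) lo hi (e : R) :
  (forall j, j \in s -> ~~ (lo j <= e <= hi j)) ->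
  exists2 d, 0 < d & forall j x, j \in s -> e <= x < e + d ->
    ~~ (lo j <= x <= hi j).
Proof.
elim: s => [|j s IH] H; first by exists 1.
have [k ks|d d0 hd] := IH; first by rewrite H // inE ks orbT.
have [d' d'0 hd'] : exists2 d', 0 < d' &
    forall x, e <= x < e + d' -> ~~ (lo j <= x <= hi j).
  have := H j (mem_head _ _); rewrite negb_and -!ltNge => /orP[je|je].
    exists (lo j - e); first lra.
    by move=> x /andP[ex xe]; rewrite negb_and -!ltNge; apply/orP; left; lra.
  exists 1 => // x /andP[ex _]; rewrite negb_and -!ltNge; apply/orP; right; lra.
exists (Num.min d d'); first by rewrite lt_min d0.
move=> k x; rewrite inE => /predU1P[->|ks] /andP[ex]; rewrite -ltrBlDl lt_min =>
  /andP[xd xd'].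
- by apply: hd'; rewrite ex -ltrBlDl.
- by apply: hd => //; rewrite ex -ltrBlDl.
Qed.

(** From [a], jump to the right end of an interval containing it, discard that interval and
    continue. No interval is used twice, so the number of jumps is at most the size of the family;
    [F] need not be continuous. *)
Lemma closed_itv_chain (s : seq I) lo hi (F : R -> R) (e a b : R) :
  0 <= e -> a <= b ->
  (forall x, a <= x <= b -> exists2 i, i \in s & lo i <= x <= hi i) ->
  (forall i x y, i \in s -> a <= x <= b -> a <= y <= b ->
     lo i <= x <= hi i -> lo i <= y <= hi i -> `|F y - F x| <= e) ->
  `|F b - F a| <= (size s)%:R * e.
Proof.
move=> e0; move: {2}(size s) (erefl (size s)) => n.
elim: n s a => [|n IH] s a sn ab cover osc.
  have [|i] := cover a; first by rewrite lexx.
  by rewrite (size0nil sn).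
have [|i iS /andP[ia ai]] := cover a; first by rewrite lexx.
have [bi|ib] := leP b (hi i).
  apply: (@le_trans _ _ e); last by rewrite sn ler_peMl // ler1n.
  by apply: (osc i); rewrite ?lexx ?ab ?ia ?ai //; lra.
have sz : size (rem i s) = n by rewrite size_rem // sn.
have cover' x : hi i < x <= b -> exists2 j, j \in rem i s & lo j <= x <= hi j.
  move=> /andP[ix xb]; have [|j jS jx] := cover x; first lra.
  exists j => //; have := jS.
  rewrite (perm_mem (perm_to_rem iS)) inE => /predU1P[ji|//].
  by move: jx; rewrite ji; lra.
have step : `|F (hi i) - F a| <= e.
  by apply: (osc i) => //; rewrite ?lexx ?ab ?ia ?ai //; lra.
have rec : `|F b - F (hi i)| <= (size (rem i s))%:R * e.
  apply: IH => //; first exact: ltW.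
    move=> x /andP[]; rewrite le_eqVlt => /predU1P[<- _|ix xb]; last first.
      by apply: cover'; rewrite ix.
    (* Points just to the right of [hi i] lie in the remaining intervals. If [hi i] itself did not,
       these closed intervals would all miss a right neighbourhood of it. *)
    have [[j ? ?]|H] := pselect (exists2 j, j \in rem i s &
      lo j <= hi i <= hi j).
      by exists j.
    have [j js|d d0 hd] := @closed_itv_gap (rem i s) lo hi (hi i).
      by apply/negP => ?; apply: H; exists j.
    pose t := Num.min b (hi i + d / 2).
    have tb : hi i < t <= b.
      by rewrite /t lt_min ge_min lexx ib /= andbT; lra.
    have te : hi i <= t < hi i + d.
      move: tb => /andP[/ltW-> _] /=; rewrite /t gt_min; apply/orP; right; lra.
    by have [j js jt] := cover' t tb; have := hd j t js te; rewrite jt.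
  move=> j x y js xi yi jx jy; have js' := mem_rem js.
  by apply: (osc j) => //; lra.
rewrite sz in rec; rewrite sn -natr1 mulrDl mul1r.
have -> : F b - F a = (F b - F (hi i)) + (F (hi i) - F a) by ring.
by apply: (le_trans (ler_normD _ _)); apply: lerD.
Qed.
End Chain.

Section Packing.
Context {R : realType}.
Implicit Types (p q z : 'cV[R]_2).
Local Notation D := quasimetricD.

(** At each height within [r] of its centre, a [D]-ball of radius [r] has as slice an interval of
    length [2 r], so its area is [4 r^2]. The sum is thus bounded by the area of a region containing
    the disjoint balls. The area is integrated by hand: first along a slice, then over the
    heights. *)
Lemma packing (rho : R) : 0 < rho -> exists2 W : R, 0 < W &
  forall p0 (I : finType) (P : I -> 'cV[R]_2) (r : I -> R),
  (forall i, D p0 (P i) <= rho) -> (forall i, 0 <= r i <= rho) ->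
  (forall i j z, i != j -> D (P i) z <= r i -> D (P j) z <= r j -> False) ->
  \sum_i r i ^+ 2 <= W.
Proof.
move=> rho0; set L := `|ln rho|; have L0 : 0 <= L by exact: normr_ge0.
(* [W1] bounds the horizontal distance from [p0] to the ends of a slice: [rho (2 + L)] for the
   centre, [rho (1 + L)] for its shift by [xlnx], and [rho] for the radius. *)
pose W1 := rho * (4 + 2 * L); exists (2 * W1 * rho).
  by rewrite /W1 !mulr_gt0 //; lra.
move=> p0 I P r P0 r0 disj.
pose row y i := `|y - P i 1 0| <= r i.
have slice y : \sum_i r i * (row y i)%:R <= W1.
  pose c i := P i 0 0 + xlnx (y - P i 1 0).
  have : \sum_i (row y i)%:R * ((c i + r i) - (c i - r i)) <=
      1 * ((p0 0 0 + W1) - (p0 0 0 - W1)).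
    apply: weighted_itv_le => //; first by rewrite /W1; nra.
    - move=> i; rewrite pnatr_eq0 eqb0 negbK /row => rowi.
      have /andP[ri0 rirho] := r0 i.
      have := quasiD_dx_bound rho0 (P0 i); rewrite -/L => px.
      have yrho : `|y - P i 1 0| <= rho by exact: le_trans rirho.
      have := xlnx_approx yrho.
      have : `|(y - P i 1 0) * ln rho| <= rho * L by rewrite normrM ler_wpM2r.
      move: px; rewrite /c /W1; set X := xlnx _; set Y := _ * ln rho.
      rewrite !mulrDr !ler_norml; set RL := rho * L => ? ? ?.
      have -> : rho * (2 * L) = 2 * RL by rewrite /RL; ring.
      by split; lra.
    - move=> x; have [i /andP[rowi ix]|none] := pickP (fun i =>
        row y i && (c i - r i <= x <= c i + r i)).
        rewrite (bigD1 i) // rowi ix mul1r big1 /= ?addr0 // => j ji.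
        have [rowj|] := boolP (row y j); last by rewrite mul0r.
        have [jx|] := boolP (_ <= x <= _); last by rewrite mulr0.
        exfalso; apply: (disj i j (vec x y)); rewrite 1?eq_sym //.
          rewrite quasiD_le !vecE -/(row y i) rowi /= ler_norml /xlnx;
            move: ix; rewrite /c /xlnx; lra.
        rewrite quasiD_le !vecE -/(row y j) rowj /= ler_norml /xlnx; move: jx;
          rewrite /c /xlnx; lra.
      rewrite big1 // => i _; have := none i.
      by case: (row y i) => /= [->|_]; rewrite ?mulr0 ?mul0r.
  rewrite (eq_bigr (fun i => 2 * (r i * (row y i)%:R))); last by move=> i _;
    ring.
  by rewrite -mulr_sumr; lra.
have : \sum_i r i * ((P i 1 0 + r i) - (P i 1 0 - r i)) <=
    W1 * ((p0 1 0 + 2 * rho) - (p0 1 0 - 2 * rho)).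
  apply: weighted_itv_le => //; first lra.
  - by rewrite /W1; nra.
  - by move=> i; have /andP[] := r0 i.
  - move=> i _; have /andP[ri0 ri] := r0 i; have :=
      le_trans (quasiD_dy _ _) (P0 i).
    by rewrite ler_norml => ?; split; lra.
  - move=> y; rewrite (eq_bigr (fun i => r i * (row y i)%:R)) // => i _.
    by congr (_ * (nat_of_bool _)%:R); rewrite /row ler_norml; apply/idP/idP;
      lra.
rewrite (eq_bigr (fun i => 2 * (r i ^+ 2))); last by move=> i _; ring.
by rewrite -mulr_sumr; lra.
Qed.
End Packing.

(** * Quasisymmetric maps preserve horizontal lines *)

Section HorizontalLines.
Context {R : realType}.
Implicit Types (f : 'cV[R]_2 ->
  'cV[R]_2) (p q z : 'cV[R]_2) (l s t tau rho : R).
Local Notation D := quasimetricD.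

Lemma ball_control f p0 (l : R) : qs_control f -> 0 < l ->
  exists2 rho, 1 <= rho & forall z, D p0 z <= l -> D (f p0) (f z) <= rho.
Proof.
move=> [h _] l0; have [B B0 hB] := h 1.
pose p1 := p0 + vec l 0.
have p1l : D p0 p1 = l.
  rewrite quasiD_horizontal /p1 ?mxE /= ?addr0 //.
  by rewrite addrAC subrr add0r gtr0_norm.
exists (B * D (f p0) (f p1) + 1).
  by rewrite lerDr mulr_ge0 ?quasiD_ge0 // ltW.
move=> z zl; apply: (@le_trans _ _ (B * D (f p0) (f p1)));
  last by rewrite lerDl.
by apply: hB; rewrite mul1r p1l.
Qed.

Definition separated f p0 (l tau : R) n :=
  exists P : 'I_n -> 'cV[R]_2, (forall i, D p0 (P i) <= l) /\
    (forall i j, i != j -> tau <= D (f (P i)) (f (P j))).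

(** A separated family of maximal cardinality is a net. Cardinalities are bounded by [packing]:
    balls of radius [tau / 9] about the image points are disjoint, since the quasi-triangle constant
    gives [8 / 9 < 1]. The factor 81 is [9^2]. *)
Lemma maximal_net f p0 l : qs_control f -> 0 < l -> exists2 A : R, 0 < A &
  forall tau, 0 < tau <= 1 -> exists n (P : 'I_n -> 'cV[R]_2),
  [/\ n%:R * tau ^+ 2 <= A, forall i, D p0 (P i) <= l,
      forall i j, i != j -> tau <= D (f (P i)) (f (P j)) &
      forall z, D p0 z <= l -> exists i, D (f (P i)) (f z) < tau].
Proof.
move=> hf l0; have [rho rho1 hrho] := ball_control p0 hf l0.
have rho0 : 0 < rho by lra.
have [W W0 hW] := packing rho0.
exists (81 * W); first lra.
move=> tau /andP[tau0 tau1].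
have bound n : separated f p0 l tau n -> n%:R * tau ^+ 2 <= 81 * W.
  move=> [P [Pl sep]].
  have := @hW (f p0) 'I_n (fun i => f (P i)) (fun=> tau / 9).
  rewrite sumr_const card_ord => H.
  have : n%:R * (tau / 9) ^+ 2 <= W.
    rewrite mulr_natl; apply: H => [i|i|i j z ij iz jz]; [by apply: hrho| |].
    - by apply/andP; split; lra.
    - have := sep _ _ ij; rewrite quasiDC in jz.
      by have := quasiD_tri iz jz; lra.
  have -> : n%:R * tau ^+ 2 = 81 * (n%:R * (tau / 9) ^+ 2) by field.
  by rewrite ler_pM2l.
pose S n := `[< separated f p0 l tau n >].
have exS : exists n, S n.
  exists 0%N; apply/asboolP; have P : 'I_0 -> 'cV[R]_2 by case.
  by exists P; split; case.
have ubS n : S n -> (n <= Num.truncn (81 * W / tau ^+ 2))%N.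
  move=> /asboolP/bound h; rewrite Num.Theory.truncn_ge_nat.
    by rewrite ler_pdivlMr // exprn_gt0.
  by rewrite divr_ge0 ?exprn_ge0 //; lra.
have [n /asboolP Sn maxn] := ex_maxnP exS ubS.
have [P [Pl sep]] := Sn.
exists n, P; split => //; first exact: bound.
move=> z zl; apply: contrapT => none.
suff /maxn : S n.+1 by rewrite ltnn.
have far i : tau <= D (f (P i)) (f z).
  by rewrite leNgt; apply/negP => lt; apply: none; exists i.
apply/asboolP; exists (fun i => oapp P z (unlift ord0 i)); split.
  by move=> i; case: unliftP => [j _|_] /=.
move=> i j; case: unliftP => [i' ->|->]; case: unliftP => [j' ->|->] //=.
- by rewrite (inj_eq lift_inj); exact: sep.
- by move=> _; rewrite quasiDC.
Qed.

(** [r] is the supremum of the distances from [p] to the points of its cell. It need not be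
    attained, so the witness reaches only half of it. *)
Lemma cell_radius f p0 l tau p : 0 < l -> 0 < tau -> D p0 p <= l ->
  exists r : R, [/\ 0 <= r <= 8 * l,
    forall z, D p0 z <= l -> D (f p) (f z) <= tau -> D p z <= r &
    exists2 z, D (f p) (f z) <= tau & r <= 2 * D p z].
Proof.
move=> l0 tau0 pl; pose S :=
  [set D p z | z in [set z | D p0 z <= l /\ D (f p) (f z) <= tau]].
have S0 : S 0.
  by exists p; rewrite /= ?quasiDxx //; split => //; exact: ltW.
have ubS : ubound S (8 * l).
  by move=> _ [z [zl _] <-]; apply: quasiD_tri zl; rewrite quasiDC.
have supS : has_sup S by split; [exists 0|exists (8 * l)].
have s0 : 0 <= sup S by apply: ub_le_sup => //; exists (8 * l).
exists (sup S); split.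
- by rewrite s0 ge_sup //; exists 0.
- by move=> z zl fz; apply: ub_le_sup; [exists (8 * l)|exists z].
- move: s0; rewrite le_eqVlt => /predU1P[<-|s0].
    by exists p; rewrite quasiDxx ?mulr0 // ltW.
  have [|_ [z [_ fz] <-] hz] := @sup_adherent _ S (sup S / 2) _ supS; first lra.
  by exists z => //; lra.
Qed.

(* A [tau]-net of the image of a ball has [O(1/tau^2)] points [f p_i]. The cells
   they control in the source contain disjoint balls of radii comparable to
   [r_i], so that [sum r_i^2 = O(1)] and, by AM-GM, [sum r_i = O(1/tau)]. Hence
   some horizontal row meets only [O(1/tau)] cells, and along it the sheared
   coordinate of the image at scale [tau] varies by [O(1)]. *)
Lemma good_row f p0 l (s0 : R) : qs_control f -> 0 < l -> 0 < s0 <= l ->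
  exists C1 C2 : R, 0 < C1 /\ forall tau, 0 < tau <= 1 -> exists2 s,
    `|s| <= s0 &
    let a := f (p0 + vec (xlnx s) s) in
    let b := f (p0 + vec (l + xlnx s) s) in
    `|(b 0 0 - b 1 0 * ln (C1 * tau)) - (a 0 0 - a 1 0 * ln (C1 * tau))| <= C2.
Proof.
move=> hf l0 /andP[s00 s0l].
have [A A0 hA] := maximal_net p0 hf l0.
have [h1 h2] := hf.
have [B B0 hB] := h1 2.
(* Cells shrunk to radius [c / 2 * r i] have images within [tau / 9] of the net points, so by the
   quasi-triangle inequality and the separation of the net they are disjoint. Capping [c] at 1 keeps
   their radii below [8 l]. *)
have e9 : (0 : R) < 9^-1 by rewrite invr_gt0.
have [c' c'0 hc'] := h2 _ e9.
pose c := Num.min c' 1.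
have c0 : 0 < c by rewrite lt_min c'0 ltr01.
have c1 : c <= 1 by rewrite ge_min lexx orbT.
have cc' : c <= c' by rewrite ge_min lexx.
have l8 : 0 < 8 * l by lra.
have [W W0 hW] := packing l8.
pose A' := (4 * W / c ^+ 2 + A) / 2.
have A'0 : 0 < A' by rewrite /A' divr_gt0 // addr_gt0 // divr_gt0 ?exprn_gt0
  //; lra.
exists (8 * B), (16 * B * (A' + 1) / s0); split; first lra.
move=> tau /andP[tau0 tau1].
have [|n [P [nA Pl sep net]]] := hA tau; first by rewrite tau0.
have [r hr] : exists r : 'I_n -> R, forall i, [/\ 0 <= r i <= 8 * l,
    forall z, D p0 z <= l -> D (f (P i)) (f z) <= tau -> D (P i) z <= r i &
    exists2 z, D (f (P i)) (f z) <= tau & r i <= 2 * D (P i) z].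
  by apply: (fin_all_exists (fun i => cell_radius f l0 tau0 (Pl i))).
have r0 i : 0 <= r i by have [/andP[]] := hr i.
have osc i z : D (P i) z <= r i -> D (f (P i)) (f z) <= B * tau.
  have [_ _ [w fw rw] zi] := hr i.
  apply: (@le_trans _ _ (B * D (f (P i)) (f w))); last by rewrite ler_pM2l.
  by apply: hB; exact: le_trans rw.
have sum_r2 : \sum_i r i ^+ 2 <= 4 * W / c ^+ 2.
  have : \sum_i (c / 2 * r i) ^+ 2 <= W.
    apply: (hW p0 _ P) => [i|i|i j z ij zi zj].
    - by apply: (le_trans (Pl i)); lra.
    - by have [/andP[ri rl] _ _] := hr i; apply/andP; split; nra.
    - have small k : D (P k) z <= c / 2 * r k -> D (f (P k)) (f z) <= tau / 9.
        have [_ _ [w fw rw] zk] := hr k.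
        apply: (@le_trans _ _ (9^-1 * D (f (P k)) (f w))); last lra.
        apply: hc'; apply: (le_trans zk).
        by have := quasiD_ge0 (P k) w; nra.
      have := sep _ _ ij; have zj' := small _ zj; rewrite quasiDC in zj'.
      by have := quasiD_tri (small _ zi) zj'; lra.
  rewrite (eq_bigr (fun i => c ^+ 2 / 4 * r i ^+ 2)); last by move=> i _; field.
  by rewrite -mulr_sumr ler_pdivlMr ?exprn_gt0 // mulrC; lra.
have sum_r : \sum_i r i <= A' / tau.
  have amgm i : r i <= (r i ^+ 2 / tau + tau) / 2.
    rewrite -subr_ge0 (_ : _ - _ = (r i - tau) ^+ 2 / (2 * tau));
      last by field; lra.
    by rewrite divr_ge0 ?sqr_ge0 //; lra.
  apply: (le_trans (ler_sum _ (fun i _ => amgm i))).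
  rewrite -mulr_suml big_split /= -mulr_suml sumr_const card_ord -(mulr_natl _
    n).
  rewrite /A' ler_pdivlMr // mulrDl mulrAC -mulrA.
  rewrite [X in _ <= X](_ : _ = 2^-1 * (4 * W / c ^+ 2 + A));
    last by rewrite mulrC.
  rewrite [X in X <= _](_ : _ = 2^-1 * (\sum_i r i ^+ 2 + n%:R * tau ^+ 2));
    last by field; lra.
  by rewrite ler_pM2l // lerD.
pose meets (y : R) i := P i 1 0 - r i <= y <= P i 1 0 + r i.
(* Averaging over heights: a cell of radius [r i] is met on an interval of length [2 r i]. If every
   height in a window of length [2 s0] met at least [(A' + 1) / (tau * s0)] cells, the sum of the
   radii would exceed [A' / tau]. *)
have [s ss0 few] : exists2 s, `|s| <= s0 &
    \sum_i (meets (p0 1 0 + s) i)%:R < (A' + 1) / (tau * s0).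
  apply: contrapT => none.
  have := @weighted_itv_ge R _ (fun i => P i 1 0 - r i) (fun i => P i 1 0 + r i)
    (fun=> 1) (p0 1 0 - s0) (p0 1 0 + s0) ((A' + 1) / (tau * s0)).
  have -> : (A' + 1) / (tau * s0) * (p0 1 0 + s0 - (p0 1 0 - s0)) = 2 * (A' /
    tau) + 2 / tau.
    by field; lra.
  rewrite (eq_bigr (fun i => 2 * r i)); last by move=> i _; ring.
  rewrite -mulr_sumr => H.
  have t0 : 0 < tau^-1 by rewrite invr_gt0.
  suff : 2 * (A' / tau) + 2 / tau <= 2 * \sum_i r i by clear H; lra.
  apply: H => //; first lra.
  - by rewrite divr_ge0 ?mulr_ge0 //; lra.
  - by move=> i; have := r0 i; lra.
  - move=> y yb; rewrite leNgt; apply/negP => lt; apply: none.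
    exists (y - p0 1 0); first by rewrite ler_norml; lra.
    rewrite addrC subrK.
    by apply: le_lt_trans lt; apply: ler_sum => i _; rewrite mul1r.
exists s => //.
pose y := p0 1 0 + s; pose x0 := p0 0 0 + xlnx s.
have ptE x : p0 + vec x s = vec (p0 0 0 + x) y by apply: vecP; rewrite !mxE.
rewrite !ptE -/x0 [p0 0 0 + (l + _)](_ : _ = x0 + l); last by rewrite /x0; ring.
set t1 := 8 * B * tau.
pose F x := f (vec x y) 0 0 - f (vec x y) 1 0 * ln t1.
rewrite /= -/(F x0) -/(F (x0 + l)).
pose c_ i := P i 0 0 + xlnx (y - P i 1 0).
have inball i x : meets y i -> c_ i - r i <= x <= c_ i + r i ->
  D (P i) (vec x y) <= r i.
  move=> yi xi; rewrite quasiD_le !vecE !ler_norml; move: yi xi;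
    rewrite /meets /c_.
  by set X := xlnx _; lra.
have t10 : 0 <= t1 by rewrite /t1 !mulr_ge0 //; lra.
pose cells := enum [pred i | meets y i].
have : `|F (x0 + l) - F x0| <= (size cells)%:R * (2 * t1).
  apply: (@closed_itv_chain _ _ cells (fun i => c_ i - r i) (fun i =>
    c_ i + r i)).
  - lra.
  - lra.
  - move=> x xl.
    have xK : D p0 (vec x y) <= l.
      rewrite quasiD_le !vecE (_ : y - p0 1 0 = s); last by rewrite /y; ring.
      by rewrite (le_trans ss0) //= ler_norml; move: xl; rewrite /x0; lra.
    have [i fi] := net _ xK; have [_ hri _] := hr i.
    have := hri _ xK (ltW fi); rewrite quasiD_le !vecE !ler_norml -/(c_ i) =>
      yxi.
    exists i; first by rewrite mem_enum inE /meets; lra.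
    by rewrite /c_; move: yxi; set X := xlnx _; lra.
  - move=> i x x'; rewrite mem_enum inE => yi _ _ xi x'i.
    have := osc _ _ (inball _ _ yi xi); rewrite quasiDC => d1.
    have := quasiD_tri d1 (osc _ _ (inball _ _ yi x'i)).
    by rewrite mulrA -/t1 => /quasiD_shear.
have -> : (size cells)%:R = \sum_i (meets y i)%:R :> R.
  by rewrite -cardE -sum1_card natr_sum big_mkcond /=; apply: eq_bigr => i _;
    rewrite inE; case: ifP.
move=> h; apply: (le_trans h).
have -> : 16 * B * (A' + 1) / s0 = (A' + 1) / (tau * s0) * (2 * t1).
  by rewrite /t1; field; rewrite !lt0r_neq0.
by rewrite ler_wpM2r // ?mulr_ge0 // ltW.
Qed.

End HorizontalLines.

Section HorizontalPreserved.
Context {R : realType}.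
Implicit Types (f : 'cV[R]_2 -> 'cV[R]_2) (p q z : 'cV[R]_2) (l s t x y : R).
Local Notation D := quasimetricD.

(* If the image of a horizontal segment changed height, so would those of all
   nearby rows, and the term [y ln tau] in [good_row] would be unbounded. *)
Lemma horizontal_preserved f p q : qs_control f -> p 1 0 = q 1 0 ->
  f p 1 0 = f q 1 0.
Proof.
move=> hf; wlog pq : p q / p 0 0 <= q 0 0 => [hw|].
  by have [pq|/ltW qp] := leP (p 0 0) (q 0 0) => e; [exact: hw|apply/esym/hw].
move: pq; rewrite le_eqVlt => /predU1P[px py|pq py].
  by congr (f _ 1 0); exact: vecP.
apply/eqP; apply: contraT => neq.
pose l := q 0 0 - p 0 0; have l0 : 0 < l by rewrite /l; lra.
pose d := `|f q 1 0 - f p 1 0|.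
have d0 : 0 < d by rewrite normr_gt0 subr_eq0 eq_sym.
have dD : d <= D (f p) (f q) by exact: quasiD_dy.
have D0 : 0 < D (f p) (f q) by exact: lt_le_trans dD.
have pqE : q = p + vec l 0.
  by apply: vecP; rewrite !mxE /= -?py /l ?addr0 //; ring.
(* With this [e], the image heights of the ends of a nearby row move by at most [d / 4] each, so at
   least [d / 2] of the vertical change survives. *)
pose e := d / (4 * D (f p) (f q)).
have e0 : 0 < e by rewrite divr_gt0 // mulr_gt0.
have [c c0 hc] := hf.2 _ e0.
pose s0 := Num.min (c * l) l.
have s00 : 0 < s0 <= l by rewrite lt_min l0 mulr_gt0 //= ge_min lexx orbT.
have Dpq : D p q = l by rewrite quasiD_horizontal // gtr0_norm.
pose ps s := p + vec (xlnx s) s; pose qs s := p + vec (l + xlnx s) s.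
have Dps s : D p (ps s) = `|s|.
  by rewrite -{1}[p]vec_eta -(quasiD_matched (p 0 0) (p 1 0)); congr D;
    apply: vecP; rewrite !mxE.
have Dqs s : D q (qs s) = `|s|.
  rewrite -{1}[q]vec_eta -(quasiD_matched (q 0 0) (q 1 0)); congr D;
    apply: vecP; rewrite !mxE /=.
    by rewrite /l; ring.
  by rewrite py.
have near_p s : `|s| <= s0 -> `|f (ps s) 1 0 - f p 1 0| <= d / 4.
  move=> ss; apply: (le_trans (quasiD_dy _ _)).
  have -> : d / 4 = e * D (f p) (f q) by rewrite /e; field; rewrite lt0r_neq0.
  by apply: hc; rewrite Dps Dpq (le_trans ss) // ge_min lexx.
have near_q s : `|s| <= s0 -> `|f (qs s) 1 0 - f q 1 0| <= d / 4.
  move=> ss; apply: (le_trans (quasiD_dy _ _)).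
  have -> : d / 4 = e * D (f q) (f p) by rewrite quasiDC /e; field;
    rewrite lt0r_neq0.
  by apply: hc; rewrite Dqs quasiDC Dpq (le_trans ss) // ge_min lexx.
have [C1 [C2 [C10 hC]]] := good_row p hf l0 s00.
have [rho rho1 hrho] := ball_control p hf l0.
have rho0 : 0 < rho by lra.
pose C3 := C2 + 2 * (rho * (2 + `|ln rho|)).
(* [tau] is taken so small that [- ln (C1 * tau) >= Z]. Since [d / 2 * Z = C3 + d / 2], this
   contradicts the upper bound [C3] on the vertical change times that logarithm. *)
pose Z := 2 * (C3 / d) + 1.
pose tau := Num.min 1 (expR (- Z) / C1).
have tau01 : 0 < tau <= 1 by rewrite lt_min ltr01 divr_gt0 ?expR_gt0 //= ge_min
  lexx.
have [s ss] := hC _ tau01; rewrite -/(ps s) -/(qs s) /=.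
have sl : `|s| <= l by case/andP: s00 => _; exact: le_trans.
have lnZ : ln (C1 * tau) <= - Z.
  rewrite -[X in _ <= X]expRK ler_ln ?posrE ?expR_gt0 //.
    by rewrite mulrC -ler_pdivlMr // ge_min lexx orbT.
  by case/andP: tau01 => ? _; exact: mulr_gt0.
have xp : `|f (ps s) 0 0 - f p 0 0| <= rho * (2 + `|ln rho|).
  by apply: quasiD_dx_bound => //; apply: hrho; rewrite Dps.
have xq : `|f (qs s) 0 0 - f p 0 0| <= rho * (2 + `|ln rho|).
  apply: quasiD_dx_bound => //; apply: hrho.
  rewrite quasiD_le !mxE /= [p 1 0 + s]addrC addrK sl /=.
  rewrite [_ + _ - _ - _](_ : _ = l); last by ring.
  by rewrite gtr0_norm.
have := near_p s ss; have := near_q s ss.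
set T := ln _ in lnZ *.
set a := f (ps s) in xp *; set b := f (qs s) in xq *.
move=> yq yp.
have big : d / 2 <= `|b 1 0 - a 1 0|.
  have e1 : f q 1 0 - f p 1 0 =
    (b 1 0 - a 1 0) - (b 1 0 - f q 1 0) + (a 1 0 - f p 1 0) by ring.
  have := ler_normD ((b 1 0 - a 1 0) - (b 1 0 - f q 1 0)) (a 1 0 - f p 1 0).
  have := ler_normB (b 1 0 - a 1 0) (b 1 0 - f q 1 0).
  by rewrite -e1 -/d; lra.
move=> h.
have C20 : 0 <= C2 by exact: le_trans h.
have K0 : 0 <= rho * (2 + `|ln rho|) by exact: le_trans xp.
have lower : `|b 1 0 - a 1 0| * - T <= C3.
  apply: (@le_trans _ _ `|(b 1 0 - a 1 0) * T|).
    by rewrite normrM ler_wpM2l // -normrN ler_norm.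
  have -> : (b 1 0 - a 1 0) * T = (b 0 0 - f p 0 0) - (a 0 0 - f p 0 0)
     - ((b 0 0 - b 1 0 * T) - (a 0 0 - a 1 0 * T)) by ring.
  apply: (le_trans (ler_normB _ _)).
  have := ler_normB (b 0 0 - f p 0 0) (a 0 0 - f p 0 0).
  by rewrite /C3; lra.
have C30 : 0 <= C3 / d by apply: divr_ge0 (ltW d0);
  rewrite addr_ge0 // mulr_ge0.
have : d / 2 * Z <= `|b 1 0 - a 1 0| * - T.
  have Z0 : 0 <= Z by rewrite /Z; lra.
  by apply: ler_pM => //; lra.
have -> : d / 2 * Z = C3 + d / 2 by rewrite /Z; field; rewrite lt0r_neq0.
lra.
Qed.

End HorizontalPreserved.

(** * Affine form of quasisymmetric maps *)

Section AdditiveVariation.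
Context {R : realType}.
Implicit Types (h : R -> R) (x y z : R).

(** Monotonicity, in a form that does not distinguish increasing from decreasing functions. *)
Definition additive_variation h := forall x y z, x <= y -> y <= z ->
  `|h z - h x| = `|h z - h y| + `|h y - h x|.

Lemma continuous_inj_additive h : continuous h -> injective h ->
  additive_variation h.
Proof.
move=> hc hi x y z xy yz.
have cw : {within [set` `]-oo, +oo[ : interval R], continuous h}.
  exact: continuous_subspaceT.
have homo_le (k : R -> R) : {in `]-oo, +oo[ &, {homo k : x y / x < y}} ->
  {homo k : x y / x <= y}.
  move=> kI s t; rewrite le_eqVlt => /predU1P[->//|st].
  by apply/ltW/kI; rewrite // in_itv.
have [incr|decr] := itv_continuous_inj_mono cw (in2W hi).
  have i := homo_le _ incr.
  have := i _ _ xy; have := i _ _ yz.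
  by move=> ? ?; rewrite !ger0_norm; lra.
have i : {homo (fun x => - h x) : x y / x <= y}.
  by apply: homo_le => s t sI tI st; rewrite ltrN2; exact: decr.
have := i _ _ xy; have := i _ _ yz.
by move=> /= ? ?; rewrite !ler0_norm; lra.
Qed.

Lemma additive_variation_le h x y z : additive_variation h ->
  x <= y -> y <= z ->
    `|h y - h x| <= `|h z - h x| /\ `|h z - h y| <= `|h z - h x|.
Proof. by move=> ha xy yz; rewrite (ha _ _ _ xy yz); split;
  rewrite ?lerDl ?lerDr. Qed.

Lemma additive_variation_sum h x (d : R) n : additive_variation h -> 0 <= d ->
  `|h (x + n%:R * d) - h x| =
  \sum_(k < n) `|h (x + k%:R * d + d) - h (x + k%:R * d)|.
Proof.
move=> ha d0; elim: n => [|n IH];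
  first by rewrite big_ord0 mul0r addr0 subrr normr0.
rewrite big_ord_recr /= -IH -natr1 mulrDl mul1r addrA [RHS]addrC.
by apply: ha; rewrite lerDl // mulr_ge0.
Qed.
End AdditiveVariation.

Section Rigidity.
Context {R : realType} (f g : 'cV[R]_2 -> 'cV[R]_2).
Context (fg : cancel f g) (gf : cancel g f) (hf : qs_control f).
Context (B : R) (B1 : 1 <= B).
Context (hB : forall p q z, quasimetricD p q <= quasimetricD p z ->
  quasimetricD (f p) (f q) <= B * quasimetricD (f p) (f z)).
Implicit Types (p q z : 'cV[R]_2) (d s t x y : R).
Local Notation D := quasimetricD.

Let B0 : 0 < B. Proof. exact: lt_le_trans B1. Qed.
Let G x y : R := f (vec x y) 0 0.
Let u y : R := f (vec 0 y) 1 0.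

Let fE x y : f (vec x y) = vec (G x y) (u y).
Proof.
by apply: vecP; rewrite vecE //; apply: horizontal_preserved; rewrite // !vecE.
Qed.

Let f_height p q : f p 1 0 = f q 1 0 -> p 1 0 = q 1 0.
Proof.
by move=> e; rewrite -(fg p) -(fg q);
  apply: horizontal_preserved (qs_control_inv fg gf hf) e.
Qed.

Let u_inj : injective u.
Proof. by move=> y y' /f_height; rewrite !vecE. Qed.

Let G_inj y : injective (G ^~ y).
Proof.
move=> x x' /= e; have := can_inj fg (x1 := vec x y) (x2 := vec x' y).
by rewrite !fE e => /(_ erefl)/(congr1 (fun p => p 0 0)); rewrite !vecE.
Qed.

(* The point [(x + d ln |d|, y + d)] realizes the distance [|d|] from [(x, y)] to
   the horizontal line of height [y + d]. *)
Let match_le x y d s : `|s| = `|d| ->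
  D (f (vec x y)) (f (vec (x + xlnx d) (y + d))) <= B * `|G (x + s) y - G x y|.
Proof.
move=> sd; have ->
  : `|G (x + s) y - G x y| = D (f (vec x y)) (f (vec (x + s) y)).
  by rewrite quasiD_horizontal ?fE ?vecE.
apply: hB; rewrite quasiD_matched quasiD_horizontal ?vecE //.
by rewrite addrAC subrr add0r sd.
Qed.

Let u_le_G x y d s : `|s| = `|d| ->
  `|u (y + d) - u y| <= B * `|G (x + s) y - G x y|.
Proof.
move=> sd; apply: le_trans (match_le x y sd).
by apply: le_trans (quasiD_dy _ _); rewrite !fE !vecE.
Qed.

(** Converse comparison: let [q] be the point at height [u (y + d)] closest to [f (x, y)]. Its
    preimage lies at height [y + d], hence at distance at least [|d|] from [(x, y)], and weak
    quasisymmetry applies. *)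
Let G_le_u x y d s : `|s| = `|d| ->
  `|G (x + s) y - G x y| <= B * `|u (y + d) - u y|.
Proof.
move=> sd; pose v := u (y + d) - u y.
pose q := vec (G x y + xlnx v) (u y + v).
have Dq : D (f (vec x y)) q = `|v| by rewrite fE quasiD_matched.
have gq : (g q) 1 0 = y + d.
  rewrite -[RHS](@vec1 _ 0); apply: f_height; rewrite gf fE !vecE.
  by rewrite /v addrC subrK.
have -> : `|G (x + s) y - G x y| = D (f (vec x y)) (f (vec (x + s) y)).
  by rewrite quasiD_horizontal ?fE ?vecE.
rewrite -/v -Dq -{1}(gf q); apply: hB.
rewrite quasiD_horizontal ?vecE // addrAC subrr add0r sd.
by apply: le_trans (quasiD_dy _ _); rewrite gq vecE addrAC subrr add0r.
Qed.

Let G_continuous y : continuous (G ^~ y).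
Proof.
move=> x; apply/cvgrPdist_le => e e0; near_simpl.
pose m := `|G (x + 1) y - G x y| + 1.
have m0 : 0 < m by rewrite /m; have := normr_ge0 (G (x + 1) y - G x y); lra.
have em0 : 0 < e / m by rewrite divr_gt0.
have [c c0 hc] := hf.2 _ em0.
near=> t.
have : D (f (vec x y)) (f (vec t y)) <= e / m * D (f (vec x y)) (f (vec (x + 1)
  y)).
  apply: hc; rewrite !quasiD_horizontal ?vecE //.
  rewrite [x + 1]addrC addrK normr1 mulr1 distrC.
  near: t; exact: cvgr_dist_le.
rewrite !quasiD_horizontal ?fE ?vecE // distrC => /le_trans; apply.
rewrite -[leRHS](@divfK _ m) ?lt0r_neq0 // ler_wpM2l ?ltW //.
by rewrite /m; lra.
Unshelve. all: by end_near.
Qed.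

Let u_continuous : continuous u.
Proof.
move=> y; apply/cvgrPdist_le => e e0; near_simpl.
have eB : 0 < e / B by rewrite divr_gt0.
near=> t.
have := @u_le_G 0 y (t - y) (t - y) erefl.
rewrite add0r (_ : y + (t - y) = t); last by ring.
rewrite [leLHS]distrC => /le_trans; apply.
rewrite mulrC -ler_pdivlMr //.
rewrite distrC; near: t.
have : (fun t => G (t - y) y) t @[t --> y] --> G (y - y) y.
  apply: (@continuous_comp _ _ _ (fun t => t - y) (G ^~ y));
    last exact: G_continuous.
  by apply: cvgB; [exact: cvg_id|exact: cvg_cst].
rewrite subrr => /cvgrPdist_le; exact.
Unshelve. all: by end_near.
Qed.

Let uA : additive_variation u.
Proof. exact: continuous_inj_additive. Qed.

Let GA y : additive_variation (G ^~ y).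
Proof. exact: continuous_inj_additive. Qed.

(** Along the line at height [y], every increment of [G] over a step [d] dominates the same quantity
    [|u (y + d) - u y| / B], wherever the step starts. About [W / d] such increments add up by
    monotonicity and are compared back with [u]; rounding [W / d] down costs the factor 2. *)
Let u_lipschitz y d W : 0 < d -> d <= W ->
  `|u (y + d) - u y| * W <= 2 * B ^+ 2 * `|u (y + W) - u y| * d.
Proof.
move=> d0 dW; pose n := Num.truncn (W / d).
have Wd : 1 <= W / d by rewrite ler_pdivlMr // mul1r.
have /andP[nW Wn] := truncn_itv (le_trans ler01 Wd).
rewrite -/n in nW Wn.
have n1 : (1 <= n)%N by rewrite /n truncn_ge_nat //; lra.
have ndW : n%:R * d <= W by rewrite -ler_pdivlMr.
have W2nd : W <= 2 * (n%:R * d).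
  move: Wn; rewrite ltr_pdivrMr // -natr1 mulrDl mul1r => ?.
  have : d <= n%:R * d by rewrite ler_peMl ?(ltW d0) // ler1n.
  lra.
have B0' := ltW B0.
set w := `|u (y + d) - u y|; have w0 : 0 <= w by exact: normr_ge0.
have nw : n%:R * w <= B ^+ 2 * `|u (y + W) - u y|.
  apply: (@le_trans _ _ (B * `|G (0 + n%:R * d) y - G 0 y|)).
    rewrite (@additive_variation_sum _ (G ^~ y)) ?(ltW d0) // mulr_sumr.
    rewrite (_ : n%:R * w = \sum_(k < n) w);
      last by rewrite sumr_const card_ord mulr_natl.
    by apply: ler_sum => k _; apply: u_le_G.
  rewrite expr2 -mulrA ler_wpM2l //.
  apply: (le_trans (G_le_u _ _ (d := n%:R * d) erefl)); rewrite ler_wpM2l //.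
  by apply: (additive_variation_le uA _ _).1;
    rewrite ?lerD2l // lerDl mulr_ge0 // (ltW d0).
apply: (@le_trans _ _ (w * (2 * (n%:R * d)))); first by rewrite ler_wpM2l.
rewrite (_ : w * _ = 2 * d * (n%:R * w)); last by ring.
rewrite (_ : 2 * _ * _ * d = 2 * d * (B ^+ 2 * `|u (y + W) - u y|));
  last by ring.
by rewrite ler_wpM2l //; lra.
Qed.

(** Matched points at height difference [d] have images within a multiple of [d]. The shear at scale
    [L * d] then contributes [ln L + ln d], and the [ln L] part is absorbed into the constant. The
    variation of [u] on [[y1 - W, y1 + W]] makes the constant uniform in [y]. *)
Let shear_step y1 (W : R) : 0 < W -> exists2 L : R, 0 < L & forall x y d,
  y1 - W <= y <= y1 -> 0 < d <= W ->
  `|u (y + d) - u y| <= L * d /\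
  `|G (x + xlnx d) (y + d) - G x y - (u (y + d) - u y) * ln d| <= L * d.
Proof.
move=> W0; pose V := `|u (y1 + W) - u (y1 - W)|.
have V0 : 0 <= V by exact: normr_ge0.
have B20 : 0 < B ^+ 2 by rewrite exprn_gt0.
pose M := 2 * B ^+ 2 * V / W; pose L := B ^+ 2 * M + 1.
have M0 : 0 <= M by rewrite /M divr_ge0 ?mulr_ge0 // ltW.
have L1 : 1 <= L by rewrite /L lerDr mulr_ge0 // ltW.
exists (L * (2 + `|ln L|)); first by rewrite mulr_gt0 //; have :=
  normr_ge0 (ln L); lra.
move=> x y d /andP[ylo yhi] /andP[d0 dW].
have uM : `|u (y + d) - u y| <= M * d.
  rewrite /M -mulrA [W^-1 * d]mulrC mulrA ler_pdivlMr //.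
  apply: (le_trans (u_lipschitz y d0 dW));
    rewrite ler_wpM2r ?(ltW d0) // ler_wpM2l ?mulr_ge0 ?(ltW B20) ?(ltW B0) //.
  have le1 : `|u (y + W) - u y| <= `|u (y + W) - u (y1 - W)|.
    by apply: (additive_variation_le uA _ _).2; lra.
  by apply: (le_trans le1); apply: (additive_variation_le uA _ _).1; lra.
have DL : D (f (vec x y)) (f (vec (x + xlnx d) (y + d))) <= L * d.
  apply: (le_trans (match_le x y (s := d) erefl)).
  apply: (@le_trans _ _ (B * (B * (M * d)))).
    rewrite ler_wpM2l ?(ltW B0) //; apply: (le_trans (G_le_u x y (d :=
      d) erefl)).
    by rewrite ler_wpM2l ?(ltW B0).
  by rewrite /L !mulrA -expr2 ler_wpM2r ?(ltW d0) // lerDl.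
have Ld0 : 0 < L * d by rewrite mulr_gt0 //; lra.
have h1' := le_trans (quasiD_dy _ _) DL.
have h2 := quasiD_shear DL.
move: h1' h2; rewrite !fE !vecE => h1' h2.
have lnL : 0 <= `|ln L| by exact: normr_ge0.
split; first by apply: (le_trans h1'); rewrite ler_pM2r // ler_peMr; lra.
set v := u (y + d) - u y in h1' *.
move: h2; rewrite lnM ?posrE; [|lra..].
rewrite (_ : _ - _ - (_ - _) = (G (x + xlnx d) (y + d) - G x y - v * ln d) - v
  * ln L); last by rewrite /v; ring.
have : `|v * ln L| <= L * d * `|ln L| by rewrite normrM ler_wpM2r.
set E := _ - v * ln d => e1 e2.
have := ler_normD (E - v * ln L) (v * ln L); rewrite subrK => /le_trans; apply.
rewrite (_ : L * (2 + _) * d = 2 * (L * d) + L * d * `|ln L|); last by ring.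
exact: lerD.
Qed.

(* Moving from height [y1 - Y] to [y1] in [n] matched steps shifts [x] by
   [Y ln (Y / n)] and its image by [(u y1 - u (y1 - Y)) ln (Y / n) + O(Y)];
   comparing [n = 1] with [n = 2 ^ k] leaves an estimate on the single line of
   height [y1]. *)
Let affine_approx y1 (W : R) : 0 < W -> exists2 K : R, 0 <= K &
  forall Y z s : R,
  0 < Y <= W -> 0 <= s ->
  `|G (z - s) y1 - G z y1 + (u y1 - u (y1 - Y)) / Y * s| <= K * Y.
Proof.
move=> W0; have [L L0 step] := shear_step y1 W0.
have chain n x y d : 0 < d <= W -> y1 - W <= y -> y + n%:R * d <= y1 ->
    `|G (x + n%:R * xlnx d) (y + n%:R * d) - G x y - (u (y + n%:R * d) - u y) *
      ln d|
      <= n%:R * (L * d).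
  move=> dW; have /andP[d0 _] := dW.
  elim: n => [|n IH] ylo;
    first by rewrite !mul0r !addr0 !subrr mul0r subrr normr0.
  rewrite -natr1 !mulrDl !mul1r !addrA => yhi.
  have nd0 : 0 <= n%:R * d by rewrite mulr_ge0 // ltW.
  have h1 := IH ylo ltac:(lra).
  have [_ h2] := step (x + n%:R * xlnx d) (y + n%:R * d) d ltac:(lra) dW.
  have := le_trans (ler_normD _ _) (lerD h1 h2).
  by congr (`|_| <= _); ring.
have ln20 : 0 < ln 2 :> R by rewrite ln_gt0 // ltr1n.
exists (L * (4 + 2 * ln 2)); first by rewrite mulr_ge0 ?(ltW L0) //; lra.
move=> Y z s /andP[Y0 YW] s0; set U := u y1 - u (y1 - Y).
have ULY : `|U| <= L * Y.
  have [] := step 0 (y1 - Y) Y _ _; [lra|lra|].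
  by rewrite subrK.
have fine n x : (0 < n)%N ->
    `|G (x + Y * ln (Y / n%:R)) y1 - G x (y1 - Y) - U * ln (Y / n%:R)| <= L * Y.
  move=> n0; have n0' : 0 < n%:R :> R by rewrite ltr0n.
  have Yn0 : 0 < Y / n%:R by rewrite divr_gt0.
  have nY : n%:R * (Y / n%:R) = Y by rewrite mulrC divfK // lt0r_neq0.
  have := chain n x (y1 - Y) (Y / n%:R).
  rewrite /xlnx (gtr0_norm Yn0) [n%:R * (_ * ln _)]mulrA nY subrK -/U => h.
  have -> : L * Y = n%:R * (L * (Y / n%:R)) by rewrite mulrCA nY.
  apply: h; rewrite ?Yn0 //=; last lra.
  by rewrite ler_pdivrMr // (le_trans YW) // ler_peMr ?ler1n // ltW.
(* Both chains start at [x - Y ln Y] on the lower line, so the value of [G] there cancels. Powers of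
   two turn the shifts [Y ln n] into multiples of [Y ln 2]. *)
have dyadic k x : `|G (x - k%:R * (Y * ln 2)) y1 - G x y1 + U * (k%:R * ln 2)|
  <= 2 * (L * Y).
  have h1 := fine 1%N (x - Y * ln Y) isT.
  have h2 := fine (2 ^ k)%N (x - Y * ln Y) ltac:(by rewrite expn_gt0).
  have lnk : ln (Y / (2 ^ k)%:R) = ln Y - k%:R * ln 2.
    rewrite ln_div ?posrE ?ltr0n ?expn_gt0 // natrX lnXn ?ltr0n //.
    by rewrite mulr_natl.
  rewrite divr1 subrK in h1; rewrite lnk in h2.
  have := le_trans (ler_normB _ _) (lerD h2 h1).
  rewrite (_ : x - Y * ln Y + Y * (ln Y - k%:R * ln 2) = x - k%:R * (Y * ln
    2)); last by ring.
  rewrite (_ : 2 * (L * Y) = L * Y + L * Y); last by ring.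
  by congr (`|_| <= _); ring.
have c0 : 0 < Y * ln 2 by rewrite mulr_gt0.
(* A general [s] is rounded down to a multiple of [Y ln 2]; monotonicity of [G] on the line controls
   the remainder. *)
pose k := Num.truncn (s / (Y * ln 2)).
have sc0 : 0 <= s / (Y * ln 2) by rewrite divr_ge0 // ltW.
have /andP[klo khi] := truncn_itv sc0.
rewrite -/k ler_pdivlMr // in klo;
  rewrite -/k ltr_pdivrMr // -natr1 mulrDl mul1r in khi.
pose x := z - k%:R * (Y * ln 2); pose r := s - k%:R * (Y * ln 2).
have r0 : 0 <= r by rewrite /r; lra.
have rc : r <= Y * ln 2 by rewrite /r; lra.
have zs : z - s = x - r by rewrite /x /r; ring.
have h1 : `|G (x - r) y1 - G x y1| <= 2 * (L * Y) + L * Y * ln 2.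
  have hA : `|G x y1 - G (x - r) y1| <= `|G x y1 - G (x - Y * ln 2) y1|.
    by apply: (additive_variation_le (GA y1) _ _).2; lra.
  rewrite distrC; apply: (le_trans hA); rewrite distrC.
  have := dyadic 1%N x; rewrite !mul1r => h.
  rewrite -[_ - _](addrK (U * ln 2)).
  apply: (le_trans (ler_normB _ _)); apply: lerD => //.
  by rewrite normrM (gtr0_norm ln20) ler_wpM2r // ltW.
have h2 := dyadic k z; rewrite -/x in h2.
have h3 : `|U * (r / Y)| <= L * Y * ln 2.
  rewrite normrM ler_pM // ger0_norm ?divr_ge0 ?(ltW Y0) //.
  by rewrite ler_pdivrMr // mulrC.
rewrite zs.
have -> : G (x - r) y1 - G z y1 + U / Y * s =
   (G (x - r) y1 - G x y1) + (G x y1 - G z y1 + U * (k%:R * ln 2)) + U * (r /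
     Y).
  by rewrite /r; field; rewrite lt0r_neq0.
apply: (le_trans (ler_normD _ _)).
have := ler_normD (G (x - r) y1 - G x y1) (G x y1 - G z y1 + U * (k%:R * ln 2)).
rewrite (_ : L * _ * Y = 4 * (L * Y) + 2 * (L * Y * ln 2)); last by ring.
lra.
Qed.

Let slope_eq (a b K : R) : (forall s, 0 <= s -> `|(a - b) * s| <= K) -> a = b.
Proof.
move=> h; apply/eqP; rewrite -subr_eq0; apply: contraT => ab.
have K0 : 0 <= K by have := h 0 (lexx 0); rewrite mulr0 normr0.
have n0 : 0 < `|a - b| by rewrite normr_gt0.
have s0 : 0 <= (K + 1) / `|a - b| by rewrite divr_ge0 ?ltW //; lra.
have := h _ s0;
  rewrite normrM [`|(K + 1) / _|]ger0_norm // mulrC divfK ?lt0r_neq0 //.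
lra.
Qed.

(** The slopes at scales [Y] and [1] approximate the same function of [s] with errors that do not
    depend on [s]. Letting [s] grow shows that they agree. *)
Let u_slope y1 (Y : R) : 0 < Y -> u y1 - u (y1 - Y) = (u y1 - u (y1 - 1)) * Y.
Proof.
move=> Y0; pose W := Num.max Y 1.
have W0 : 0 < W by rewrite lt_max Y0.
have [K K0 hK] := affine_approx y1 W0.
rewrite -[LHS](@divfK _ Y) ?lt0r_neq0 //; congr (_ * _).
rewrite -[RHS]divr1; apply: (@slope_eq _ _ (K * Y + K * 1)) => s s0.
have h1 := hK Y 0 s _ s0; have h2 := hK 1 0 s _ s0.
have := le_trans (ler_normB _ _) (lerD (h1 _) (h2 _)).
rewrite !le_max !lexx Y0 ltr01 orbT => /(_ isT isT).
by congr (`|_| <= _); ring.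
Qed.

Let a := u 0 - u (0 - 1).

Let uE y : u y = u 0 + a * y.
Proof.
have [y0|y0|->] := ltgtP y 0; last by rewrite mulr0 addr0.
  have := @u_slope 0 (- y); rewrite oppr_gt0 => /(_ y0).
  by rewrite sub0r opprK -/a; lra.
(* The slope at [y] is read over the lengths [y] and [y + 1]; subtracting the two relations
   identifies it with [a]. *)
have h1 := u_slope y y0; have h2 := @u_slope y (y + 1) ltac:(lra).
have e1 : y - (y + 1) = 0 - 1 by ring.
rewrite subrr in h1; rewrite e1 in h2.
by rewrite /a; nra.
Qed.

Let GE x y : G x y = a * x + G 0 y.
Proof.
have key (z s : R) : 0 <= s -> G (z - s) y - G z y = - (a * s).
  move=> s0; have [K K0 hK] := affine_approx y (@ltr01 R).
  apply/eqP; rewrite -subr_eq0 opprK -normr_le0; apply/ler_addgt0Pr => e e0.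
  rewrite add0r; pose Y := Num.min 1 (e / (K + 1)).
  have K1 : 0 < K + 1 by lra.
  have Y0 : 0 < Y <= 1 by rewrite lt_min ltr01 divr_gt0 //= ge_min lexx.
  have /andP[Yp _] := Y0.
  have := hK Y z s Y0 s0; rewrite [u y]uE [u (y - Y)]uE.
  rewrite (_ : (_ - _) / Y = a); last by field; rewrite lt0r_neq0.
  move=> /le_trans; apply; apply: (@le_trans _ _ ((K + 1) * Y)).
    by rewrite ler_wpM2r ?(ltW Yp) //; lra.
  by rewrite mulrC -ler_pdivlMr // ge_min lexx orbT.
have [x0|x0|->] := ltgtP x 0; last by rewrite mulr0 add0r.
  by have := key 0 (- x) ltac:(lra); rewrite opprK add0r; lra.
by have := key x x (ltW x0); rewrite subrr; lra.
Qed.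

Lemma rigid_form : exists (a b : R) (C : R -> R), [/\ a != 0,
  forall p, f p = vec (a * p 0 0 + C (p 1 0)) (a * p 1 0 + b) &
  exists K, forall y s,
    `|C (y + s) - a * ln `|a| * (y + s) - (C y - a * ln `|a| * y)| <= K * `|s|].
Proof.
have a0 : a != 0.
  apply/eqP => a0;
    have /u_inj/eqP : u 0 = u 1 by rewrite [u 1]uE a0 mul0r addr0.
  by rewrite eq_sym oner_eq0.
exists a, (u 0), (G 0); split => //.
  by move=> p; rewrite -{1}[p]vec_eta fE GE uE [u 0 + _]addrC.
exists (B * `|a|) => y s.
have [->|s0] := eqVneq s 0; first by rewrite addr0 subrr !normr0 mulr0.
(* For a matched pair, the second term of [D] between the images is exactly the increment of
   [C y - a ln|a| y], the linear correction coming from [xlnxM]. *)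
have := match_le 0 y (s := s) erefl; move=> /(le_trans (quasiD_dx _ _)).
rewrite !fE !vecE !add0r (GE (xlnx s)) (GE s) (uE (y + s)) (uE y).
rewrite (_ : u 0 + a * (y + s) - (u 0 + a * y) = a * s); last by ring.
rewrite xlnxM // addrK normrM mulrA.
by congr (`|_| <= _); ring.
Qed.

End Rigidity.

(** * Hausdorff-null sets and conformal points *)

Section CousinInduction.
Context {R : realType}.

(** The supremum of the points reachable from [a] is reachable and cannot lie below [b]. This serves
    in place of compactness, both to extract finite covers and to add up local estimates. *)
Lemma cousin_induction (a b : R) (Q : R -> R -> Prop) : a <= b ->
  (forall x y z, x <= y -> y <= z -> Q x y -> Q y z -> Q x z) ->
  (forall t, a <= t <= b -> exists2 r, 0 < r & forall x y,
     t - r < x <= t -> t <= y < t + r -> Q x y) ->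
  Q a b.
Proof.
move=> ab trans loc.
have Qtt t : a <= t <= b -> Q t t.
  by move=> /loc[r r0 hr]; apply: hr; lra.
pose S := [set t | a <= t <= b /\ Q a t].
have Sa : S a by split; [lra|apply: Qtt; lra].
have Sb : ubound S b by move=> t [/andP[]].
have supS : has_sup S by split; [exists a|exists b].
pose t := sup S.
have tab : a <= t <= b.
  apply/andP; split; first by apply: ub_le_sup => //; exists b.
  by apply: ge_sup => //; exists a.
have [r r0 hr] := loc t tab.
have [x [xab Qx] tx] := sup_adherent r0 supS; rewrite -/t in tx.
have xt : x <= t by apply: ub_le_sup; [exists b|].
pose y := Num.min b (t + r / 2).
have yt : t <= y < t + r.
  by rewrite /y le_min gt_min; apply/andP; split; [apply/andP; split;
    lra|apply/orP; right; lra].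
have yb : y <= b by rewrite ge_min lexx.
have Qay : Q a y.
  by apply: (trans a x y) => //; [lra|lra|apply: hr; lra].
have yt' : y <= t by apply: ub_le_sup; [exists b|split => //; lra].
have : y = t by lra.
rewrite /y; case: (leP b (t + r / 2)) => [bt|bt]; last lra.
by move=> bE; move: Qay; rewrite /y (min_idPl bt).
Qed.
End CousinInduction.

(** * The Hausdorff dimension of the plane with [D] is at most 2 *)

Section HausdorffPlane.
Context {R : realType}.
Implicit Types (p q z : 'cV[R]_2) (s delta e : R).
Local Notation D := quasimetricD.

Lemma hausdorff_gauge_ge0 s (U : set 'cV[R]_2) : (0 <= hausdorff_gauge D s U)%E.
Proof. by rewrite /hausdorff_gauge; case: ifP => // _; exact: poweR_ge0. Qed.

Lemma diam_ball p (tau : R) : 0 <= tau ->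
  (diam D [set z | (D p z < tau)%R] <= (8 * tau)%:E)%E.
Proof.
move=> tau0; apply: ge_ereal_sup => _ [[x y] [/= /ltW xp /ltW yp] <-].
by rewrite lee_fin; apply: (quasiD_tri (q := p)) => //; rewrite quasiDC.
Qed.

(* [maximal_net] for the identity map provides the cover. *)
Lemma ball_cover s delta e p (l : R) : 2 < s -> 0 < delta -> 0 < e -> 0 < l ->
  exists V : nat -> set 'cV[R]_2, [/\ [set z | D p z <= l] `<=` \bigcup_k V k,
    forall k, (diam D (V k) <= delta%:E)%E &
    (\sum_(0 <= k <oo) hausdorff_gauge D s (V k) <= e%:E)%E].
Proof.
move=> s2 d0 e0 l0.
have qs_id : qs_control (@id 'cV[R]_2).
  split=> [T|c c0]; last by exists c.
  exists (`|T| + 1); first by have := normr_ge0 T; lra.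
  move=> x y z /le_trans; apply; rewrite ler_wpM2r ?quasiD_ge0 //.
  by have := ler_norm T; lra.
have [A A0 hA] := maximal_net p qs_id l0.
have s2' : 0 < s - 2 by lra.
(* The [n] sets of diameter at most [8 tau] have total gauge at most [8^s (n tau^2) tau^(s - 2)],
   which is at most [8^s A eta = e]. *)
pose eta := e / (8 `^ s * A).
have eta0 : 0 < eta by rewrite divr_gt0 // mulr_gt0 // powR_gt0.
pose tau := Num.min 1 (Num.min (delta / 8) (eta `^ (s - 2)^-1)).
have tau0 : 0 < tau by rewrite !lt_min ltr01 divr_gt0 //= powR_gt0.
have tau1 : tau <= 1 by rewrite ge_min lexx.
have taud : 8 * tau <= delta.
  by rewrite mulrC -ler_pdivlMr // /tau !ge_min lexx orbT.
have taue : tau `^ (s - 2) <= eta.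
  have -> : eta = (eta `^ (s - 2)^-1) `^ (s - 2).
    by rewrite -powRrM mulVf ?powRr1 ?lt0r_neq0 // ltW.
  rewrite ge0_ler_powR ?nnegrE ?(ltW tau0) ?powR_ge0 ?(ltW s2') //.
  by rewrite /tau !ge_min lexx !orbT.
have [|n [P [nA _ _ net]]] := hA tau; first by rewrite tau0.
pose V k := if insub k is Some i then [set z | D (P i) z < tau] else set0.
have V0 k : (n <= k)%N -> V k = set0.
  by move=> nk; rewrite /V insubF // ltnNge nk.
have Vd k : (diam D (V k) <= (8 * tau)%:E)%E.
  rewrite /V; case: insubP => [i _ _|_]; first exact/diam_ball/ltW.
  by apply: ge_ereal_sup => v [[x y] [[]]].
exists V; split.
- move=> z zl; have [i zi] := net z zl; exists i => //.
  by rewrite /V valK.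
- by move=> k; apply: (le_trans (Vd k)); rewrite lee_fin.
- have Vg k : (hausdorff_gauge D s (V k) <= ((8 * tau) `^ s)%:E)%E.
    rewrite /hausdorff_gauge; case: eqP => [_|/eqP/set0P[z Vz]].
      by rewrite lee_fin powR_ge0.
    have dz : (0 <= diam D (V k))%E.
      by apply: ereal_sup_ubound; exists (z, z) => //=; rewrite quasiDxx.
    rewrite -poweR_EFin; apply: gt0_ler_poweR;
      rewrite ?in_itv /= ?leey ?andbT //; first lra.
    by rewrite lee_fin mulr_ge0 // ltW.
  rewrite (nneseries_split _ n); last by move=> k _; exact: hausdorff_gauge_ge0.
  rewrite [X in (_ + X)%E]eseries0 ?adde0; last first.
    by move=> k nk _; rewrite V0 // /hausdorff_gauge eqxx.
  rewrite add0n big_mkord;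
    apply: (@le_trans _ _ (\sum_(i < n) ((8 * tau) `^ s)%:E)%E).
    by apply: lee_sum => i _; exact: Vg.
  rewrite sumEFin lee_fin sumr_const card_ord -[leLHS]mulr_natl.
  have -> : (8 * tau) `^ s = 8 `^ s * (tau ^+ 2 * tau `^ (s - 2)).
    rewrite powRM ?(ltW tau0) // -powR_mulrn ?(ltW tau0) // -powRD.
      by congr (_ * _ `^ _); ring.
    by rewrite lt0r_neq0 ?implybT.
  have p8 : 0 < 8 `^ s :> R by rewrite powR_gt0.
  rewrite [leLHS](_ : _ = 8 `^ s * ((n%:R * tau ^+ 2) * tau `^ (s - 2)));
    last by ring.
  rewrite mulrC -ler_pdivlMr // (@le_trans _ _ (A * eta)) //.
    by rewrite ler_pM ?powR_ge0 // mulr_ge0 ?sqr_ge0.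
  by rewrite /eta le_eqVlt; apply/orP; left; apply/eqP; field;
    rewrite !lt0r_neq0.
Qed.

Lemma hausdorff_measure_plane s : 2 < s ->
  hausdorff_measure D s [set: 'cV[R]_2] = 0%E.
Proof.
move=> s2.
have pre_ge0 delta (E : set 'cV[R]_2) : (0 <= hausdorff_premeasure D s delta
  E)%E.
  apply: le_ereal_inf_tmp => _ [U _ <-]; apply: nneseries_ge0 => k _ _.
  exact: hausdorff_gauge_ge0.
apply/eqP; rewrite eq_le; apply/andP; split; last first.
  apply: le_trans (pre_ge0 1 setT) _.
  by apply: ereal_sup_ubound; exists 1 => //=.
apply: ge_ereal_sup => _ [delta /= d0 <-].
apply/lee_addgt0Pr => e e0; rewrite add0e.
have cov t : exists V : nat -> set 'cV[R]_2,
   [/\ [set z | D 0 z <= t.+1%:R] `<=` \bigcup_k V k,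
    forall k, (diam D (V k) <= delta%:E)%E &
    (\sum_(0 <= k <oo) hausdorff_gauge D s (V k) <= (e / (2 ^ t.+1)%:R)%:E)%E].
  by apply: ball_cover => //; rewrite divr_gt0 // ltr0n expn_gt0.
have [V hV] := choice cov.
have [f fbij] : exists f : nat -> nat * nat, set_bij setT setT f.
  by apply/card_set_bijP; rewrite card_eq_sym card_nat2.
pose W (k : nat * nat) := V k.1 k.2.
apply: (@le_trans _ _ (\sum_(0 <= k <oo) hausdorff_gauge D s (W (f k)))%E).
  apply: ereal_inf_lbound; exists (W \o f) => //; split; last first.
    by move=> k; have [_ + _] := hV (f k).1; exact.
  move=> z _; pose t := Num.truncn (D 0 z).
  have [+ _ _] := hV t => /(_ z)[|k _ zk].
    by have /andP[_ /ltW] := truncn_itv (quasiD_ge0 0 z).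
  have [_ _ /(_ (t, k) I)[j _ fj]] := fbij.
  by exists j => //=; rewrite fj.
have gW k : (0 <= hausdorff_gauge D s (W k))%E by exact: hausdorff_gauge_ge0.
rewrite nneseries_esumT //.
rewrite -(reindex_esum setT setT f (fun k => hausdorff_gauge D s (W k))) //.
rewrite (_ : setT = setT `*`` (fun=> setT)); last by apply/seteqP; split.
rewrite -(@esum_esum _ _ _ setT (fun=> setT) (fun t k =>
  hausdorff_gauge D s (V t k))); last first.
  by move=> *; exact: hausdorff_gauge_ge0.
rewrite -nneseries_esumT; last by move=> t; apply: esum_ge0 => k _;
  exact: hausdorff_gauge_ge0.
apply: (le_trans _ (epsilon_trick0 xpredT (ltW e0))); apply: lee_nneseries.
  by move=> t _ _; apply: esum_ge0 => k _; exact: hausdorff_gauge_ge0.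
move=> t _; rewrite -nneseries_esumT; last by move=> k;
  exact: hausdorff_gauge_ge0.
by have [] := hV t.
Qed.

Lemma hausdorff_dim_plane :
  0 <= fine (hausdorff_dim (@quasimetricD R)) <= 2.
Proof.
have lo : (0 <= hausdorff_dim (@quasimetricD R))%E.
  by apply: le_ereal_inf_tmp => _ [s [s0 _] <-]; rewrite lee_fin.
have hi : (hausdorff_dim (@quasimetricD R) <= 2%:E)%E.
  apply/lee_addgt0Pr => e e0; apply: ereal_inf_lbound; exists (2 + e) => //.
  by split; [lra|apply: hausdorff_measure_plane; lra].
rewrite fine_ge0 //= -lee_fin fineK // fin_numElt (lt_le_trans _ lo) ?ltNyr //.
exact: le_lt_trans hi (ltry _).
Qed.
End HausdorffPlane.

Section NullSets.
Context {R : realType}.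
Implicit Types (p q z : 'cV[R]_2) (s x y e : R).
Local Notation D := quasimetricD.

Definition flat_at (h : R -> R) y := forall e, 0 < e -> exists2 r, 0 < r &
  forall s, `|s| < r -> `|h (y + s) - h y| <= e * `|s|.

(** For a diameter [d <= 1] and an exponent [sigma <= 2] one has [d^2 <= d^sigma]. An upper bound on
    the dimension therefore suffices to cover null sets with small sum of squared radii. *)
Lemma hausdorff_gauge_bound sigma (U : set 'cV[R]_2) : 0 <= sigma <= 2 ->
  (diam D U <= 1%:E)%E -> exists pd : 'cV[R]_2 * R,
  [/\ 0 <= pd.2, forall z, U z -> D pd.1 z <= pd.2 &
      ((pd.2 ^+ 2)%:E <= hausdorff_gauge D sigma U)%E].
Proof.
move=> /andP[s0 s2] dU; have [->|/set0P[p Up]] := eqVneq U set0.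
  by exists (0, 0) => /=; split => //; rewrite expr0n /=;
    exact: hausdorff_gauge_ge0.
have dU0 : (0 <= diam D U)%E.
  by apply: ereal_sup_ubound; exists (p, p) => //=; rewrite quasiDxx.
have fU : diam D U \is a fin_num.
  by rewrite fin_numElt (lt_le_trans _ dU0) ?ltNyr //= (le_lt_trans dU) // ltry.
pose d := fine (diam D U).
have dE : diam D U = d%:E by rewrite /d fineK.
have d0 : 0 <= d by rewrite -lee_fin -dE.
have d1 : d <= 1 by rewrite -lee_fin -dE.
exists (p, d); split => //= [z Uz|].
  by rewrite -lee_fin -dE; apply: ereal_sup_ubound; exists (p, z).
rewrite /hausdorff_gauge ifF; last by apply/negbTE/set0P; exists p.
rewrite dE poweR_EFin lee_fin -powR_mulrn //.
have [->|dn0] := eqVneq d 0; first by rewrite powR0 ?powR_ge0 // pnatr_eq0.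
by apply: ger_powR => //; rewrite lt0r dn0 d0.
Qed.

Lemma hausdorff_null_cover sigma (N : set 'cV[R]_2) e : 0 <= sigma <= 2 ->
  hausdorff_measure D sigma N = 0%E -> 0 < e ->
  exists (P : nat -> 'cV[R]_2) (d : nat -> R), [/\ forall k, 0 < d k,
    forall z, N z -> exists k, D (P k) z < d k &
    forall n, \sum_(k < n) d k ^+ 2 <= e].
Proof.
move=> s02 N0 e0.
pose e1 := Num.min (e / 4) 1.
have e10 : 0 < e1 by rewrite lt_min ltr01 divr_gt0.
have e1e : e1 <= e / 4 by rewrite ge_min lexx.
have e11 : e1 <= 1 by rewrite ge_min lexx orbT.
have : (hausdorff_premeasure D sigma 1 N < e1%:E)%E.
  apply: (@le_lt_trans _ _ 0%E); last by rewrite lte_fin.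
  by rewrite -N0; apply: ereal_sup_ubound; exists 1 => //=.
move=> /ereal_inf_lt[_ [U [NU dU] <-]] sumU.
have [pd hpd] := choice (fun k => hausdorff_gauge_bound s02 (dU k)).
(* Enlarging the radii by [q k] makes them positive and the balls open, at the cost
   [(d + q)^2 <= 2 (d^2 + q)] for [q <= 1]. The total is then at most [4 e1 <= e]. *)
pose q k : R := e1 / (2 ^ k.+1)%:R.
have q0 k : 0 < q k by rewrite divr_gt0 // ltr0n expn_gt0.
have q1 k : q k <= 1.
  by rewrite ler_pdivrMr ?ltr0n ?expn_gt0 // mul1r (le_trans e11) // ler1n
    expn_gt0.
exists (fun k => (pd k).1), (fun k => (pd k).2 + q k); split.
- by move=> k; have [? _ _] := hpd k; have := q0 k; lra.
- move=> z /NU[k _ Uz]; exists k; have [_ + _] := hpd k => /(_ z Uz).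
  by have := q0 k; lra.
- move=> n.
  have sumd : \sum_(k < n) (pd k).2 ^+ 2 <= e1.
    rewrite -lee_fin; apply: le_trans (ltW sumU).
    rewrite -sumEFin.
    apply: (@le_trans _ _ (\sum_(k < n) hausdorff_gauge D sigma (U k))%E).
      by apply: lee_sum => k _; have [] := hpd k.
    rewrite -(big_mkord xpredT (fun k => hausdorff_gauge D sigma (U k))).
    by apply: nneseries_lim_ge => *; exact: hausdorff_gauge_ge0.
  have sumq : \sum_(k < n) q k <= e1.
    rewrite -lee_fin; apply: le_trans (epsilon_trick0 xpredT (ltW e10)).
    rewrite -sumEFin -(big_mkord xpredT (fun k => (q k)%:E)).
    by apply: nneseries_lim_ge => *; rewrite lee_fin ltW.
  have term k : ((pd k).2 + q k) ^+ 2 <= 2 * ((pd k).2 ^+ 2 + q k).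
    rewrite -subr_ge0 (_ : _ - _ = ((pd k).2 - q k) ^+ 2 + 2 * (q k * (1 - q
      k))); last by ring.
    by rewrite addr_ge0 ?sqr_ge0 // mulr_ge0 // mulr_ge0 ?subr_ge0 // ltW.
  apply: (@le_trans _ _ (\sum_(k < n) 2 * ((pd k).2 ^+ 2 + q k))).
    by apply: ler_sum => k _; exact: term.
  by rewrite -mulr_sumr big_split /=; lra.
Qed.

(** [cousin_induction] extracts finitely many closed intervals covering [[0, 1]]. Their total
    length, twice the sum of the selected radii, is at least 1. *)
Lemma itv_cover_finite (c r : nat -> R) (A : pred nat) :
  (forall x, 0 <= x <= 1 -> exists2 k, A k & `|x - c k| < r k) ->
  (forall k, 0 <= r k) ->
  exists n, 2^-1 <= \sum_(k < n) r k * (A k)%:R.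
Proof.
move=> cov r0.
pose Q x y := exists n : nat, forall t, x <= t <= y ->
  exists2 k, (k < n)%N && A k & `|t - c k| <= r k.
have [n hn] : Q 0 1.
  apply: cousin_induction => //.
    move=> x y z xy yz [n1 h1] [n2 h2]; exists (maxn n1 n2) => t /andP[xt tz].
    have [ty|yt] := leP t y.
      have [|k /andP[kn Ak] tk] := h1 t; first by rewrite xt.
      by exists k; rewrite // Ak leq_max kn.
    have [|k /andP[kn Ak] tk] := h2 t; first by rewrite tz ltW.
    by exists k; rewrite // Ak leq_max kn orbT.
  move=> t t01; have [k Ak tk] := cov t t01.
  exists (r k - `|t - c k|); first lra.
  move=> x y tx ty; exists k.+1 => w xwy; exists k; first by rewrite ltnSn.
  have -> : w - c k = (w - t) + (t - c k) by ring.
  apply: (le_trans (ler_normD _ _)).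
  have : `|w - t| <= r k - `|t - c k| by rewrite ler_norml; lra.
  lra.
exists n.
have := @weighted_itv_ge R _ (fun k : 'I_n => c k - r k) (fun k : 'I_n =>
  c k + r k)
  (fun k : 'I_n => (A k)%:R) 0 1 1 ler01 ler01 _ _ _.
rewrite subr0 mulr1 (eq_bigr (fun k : 'I_n => 2 * (r k * (A k)%:R)));
  last by move=> k _; ring.
rewrite -mulr_sumr => H;
  suff : 1 <= 2 * (\sum_(k < n) r k * (A k)%:R) by clear H; lra.
apply: H => //.
- by move=> k; have := r0 k; lra.
- move=> x x01; have [k /andP[kn Ak] xk] := hn x x01.
  rewrite (bigD1 (Ordinal kn)) //= Ak mul1r (_ : _ <= x <= _) /=; last first.
    by move: xk; rewrite ler_norml; lra.
  by rewrite lerDl sumr_ge0 // => i _; rewrite mulr_ge0.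
Qed.

(* Over a height [y] whose whole horizontal line lies in [N], the slices of the
   covering balls cover [0, 1], hence the sum of the radii of the balls met is at
   least [1/2]. So the increasing function [M n], of total variation at most
   [2 sum d_k^2], grows at rate at least [1/2] at such heights and dominates [h]
   there. *)
Lemma lipschitz_flat_const sigma (N : set 'cV[R]_2) (h : R -> R) K :
  0 <= sigma <= 2 -> hausdorff_measure D sigma N = 0%E ->
  (forall y s, `|h (y + s) - h y| <= K * `|s|) ->
  (forall x y, ~ N (vec x y) -> flat_at h y) ->
  forall a b, h a = h b.
Proof.
move=> s02 N0 lip flat a b; wlog ab : a b / a <= b => [hw|].
  by have [ab|/ltW ba] := leP a b; [exact: hw|apply/esym/hw].
have K0 : 0 <= K.
  by have := lip 0 1; rewrite normr1 mulr1; exact: le_trans.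
apply/eqP; rewrite eq_sym -subr_eq0 -normr_le0; apply/ler_addgt0Pr => e' e'0.
rewrite add0r.
pose e := e' / (b - a + 4 * K + 1).
have den : 0 < b - a + 4 * K + 1 by lra.
have e0 : 0 < e by rewrite divr_gt0.
have [P [d [d0 cov sumd]]] := hausdorff_null_cover s02 N0 e0.
pose lo k := P k 1 0 - d k; pose hi k := P k 1 0 + d k.
(* Clamping [y] to the heights of the [k]-th ball makes [d k * cl k y] grow with slope [d k] over
   that ball and stay constant elsewhere. *)
pose cl k y := Num.max (lo k) (Num.min y (hi k)).
pose M n y := \sum_(k < n) d k * cl k y.
have cl_homo k x y : x <= y -> cl k x <= cl k y.
  move=> xy; rewrite /cl ge_max !le_max lexx /= !le_min !ge_min lexx orbT xy /=
    orbT.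
  by [].
have Mincr n m x y : (n <= m)%N -> x <= y -> M n y - M n x <= M m y - M m x.
  move=> nm xy; rewrite /M -!sumrB.
  rewrite (big_ord_widen m (fun k => d k * cl k y - d k * cl k x) nm).
  rewrite big_mkcond /=; apply: ler_sum => k _; case: ifP => // _.
  by rewrite -mulrBr mulr_ge0 ?(ltW (d0 _)) // subr_ge0 cl_homo.
(* The number of balls needed depends on the height. Increments of [M n] grow with [n], so adjacent
   estimates combine at the larger index. *)
pose Q x y := exists n, `|h y - h x| <= e * (y - x) + 2 * K * (M n y - M n x).
have [n hn] : Q a b.
  apply: cousin_induction => //.
    move=> x y z xy yz [n1 h1] [n2 h2]; exists (maxn n1 n2).
    have i1 := Mincr _ _ _ _ (leq_maxl n1 n2) xy.
    have i2 := Mincr _ _ _ _ (leq_maxr n1 n2) yz.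
    have j1 := ler_wpM2l (mulr_ge0 (ler0n R 2) K0) i1.
    have j2 := ler_wpM2l (mulr_ge0 (ler0n R 2) K0) i2.
    have -> : h z - h x = (h z - h y) + (h y - h x) by ring.
    by apply: (le_trans (ler_normD _ _)); lra.
  move=> t _; have [[x0 /flat fl]|bad] := pselect (exists x, ~ N (vec x t)).
    have [r r0 hr] := fl _ e0; exists r => // x y xt ty; exists 0%N.
    rewrite /M !big_ord0 subrr mulr0 addr0.
    have := hr (x - t); have := hr (y - t).
    rewrite ![t + (_ - t)]addrC !subrK [`|y - t|]ger0_norm; last lra.
    rewrite [`|x - t|]ler0_norm; last lra.
    move=> /(_ ltac:(lra)) h1 /(_ ltac:(lra)) h2.
    have -> : h y - h x = (h y - h t) - (h x - h t) by ring.
    by apply: (le_trans (ler_normB _ _)); lra.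
  pose A k := `|t - P k 1 0| < d k.
  have [|n hn] := @itv_cover_finite (fun k =>
    P k 0 0 + xlnx (t - P k 1 0)) d A _ (fun k => ltW (d0 k)).
    move=> x _; have /cov[k] : N (vec x t) by apply: contrapT => nN;
      apply: bad; exists x.
    rewrite /quasimetricD !vecE gt_max => /andP[tk xk]; exists k => //.
    by rewrite opprD addrA.
  have [r r0 hr] : exists2 r, 0 < r & forall k, (k < n)%N -> A k ->
    `|t - P k 1 0| + r <= d k.
    elim: n {hn} => [|n [r r0 hr]]; first by exists 1.
    have [An|An] := boolP (A n); last first.
      exists r => // k; rewrite ltnS leq_eqVlt => /predU1P[->|/hr//].
      by rewrite (negbTE An).
    exists (Num.min r (d n - `|t - P n 1 0|));
      first by rewrite lt_min r0 subr_gt0.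
    move=> k; rewrite ltnS leq_eqVlt => /predU1P[-> _|/hr hk /hk {}hk].
      by rewrite -lerBrDl ge_min lexx orbT.
    by apply: le_trans hk; rewrite lerD2l ge_min lexx.
  exists r => // x y xt ty; exists n.
  have yx0 : 0 <= y - x by lra.
  have big : (y - x) / 2 <= M n y - M n x.
    apply: (@le_trans _ _ ((y - x) * \sum_(k < n) d k * (A k)%:R));
      first by rewrite ler_wpM2l.
    rewrite mulr_sumr /M -sumrB; apply: ler_sum => k _;
      rewrite -mulrBr mulrCA ler_pM2l //.
    have [Ak|_] := boolP (A k); last by rewrite mulr0 subr_ge0 cl_homo //; lra.
    have := hr k (ltn_ord k) Ak; rewrite mulr1.
    have [tk1 tk2] : P k 1 0 - t <= `|t - P k 1 0| /\ t - P k 1 0 <= `|t - P k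
      1 0|.
      by rewrite ler_norm distrC ler_norm.
    move=> tk; have clE w : t - r < w < t + r -> cl k w = w.
      move=> wt; rewrite /cl /lo /hi (min_idPl _) ?(max_idPr _) //; lra.
    by rewrite !clE //; lra.
  have lipxy : `|h y - h x| <= K * (y - x).
    by have := lip x (y - x); rewrite [x + _]addrC subrK (ger0_norm yx0).
  apply: (le_trans lipxy); apply: (@le_trans _ _ (2 * K * ((y - x) / 2))).
    by rewrite le_eqVlt; apply/orP; left; apply/eqP; field.
  apply: (@le_trans _ _ (2 * K * (M n y - M n x))).
    by rewrite ler_wpM2l // mulr_ge0.
  by rewrite lerDr mulr_ge0 // ltW.
have Mab : M n b - M n a <= 2 * e.
  rewrite /M -sumrB; apply: (@le_trans _ _ (\sum_(k < n) 2 * d k ^+ 2));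
    last first.
    by rewrite -mulr_sumr ler_pM2l.
  apply: ler_sum => k _; rewrite -mulrBr.
  rewrite (_ : 2 * d k ^+ 2 = d k * (hi k - lo k)); last by rewrite /hi /lo;
    ring.
  rewrite ler_pM2l // lerB //.
    rewrite /cl ge_max ge_min lexx orbT andbT /hi /lo; have := d0 k; lra.
  by rewrite /cl le_max lexx.
apply: (le_trans hn); rewrite (_ : e' = e * (b - a + 4 * K + 1)); last first.
  by rewrite /e divfK // lt0r_neq0.
have := ler_wpM2l (mulr_ge0 (ler0n R 2) K0) Mab.
rewrite (_ : e * (_ + 1) = e * (b - a) + 2 * K * (2 * e) + e); last by ring.
lra.
Qed.
End NullSets.

Section ConformalPoints.
Context {R : realType}.
Implicit Types (p q z : 'cV[R]_2) (s x y e : R).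
Local Notation D := quasimetricD.

(* Points at distance [r] on the same horizontal line bound the lower
   dilatation by [|a|]; matched points at height difference [s] then make the upper
   dilatation exceed it unless [h (y + s) - h y = o(s)]. *)
Lemma conformal_flat f (a b : R) (C : R -> R) p : a != 0 ->
  (forall p, f p = vec (a * p 0 0 + C (p 1 0)) (a * p 1 0 + b)) ->
  conformal_at D D f p -> flat_at (fun y => C y - a * ln `|a| * y) (p 1 0).
Proof.
move=> a0 fE [ul _ _]; set h := fun y => _.
have lower : (lower_dilatation D D f p <= `|a|%:E)%E.
  rewrite /lower_dilatation limf_einfE; apply: ge_ereal_sup => _ [V V0 <-].
  have [r r0 Vr] : exists2 r, 0 < r & V r.
    have FV : \forall r \near (0 : R)^'+, 0 < r /\ V r.
      by near=> r; split; near: r; [exact: nbhs_right_gt|exact: V0].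
    have [r [? ?]] := @filter_ex _ _ (at_right_proper_filter _) _ FV.
    by exists r.
  apply: (@le_trans _ _ (lower_dist D D f p r * (r^-1)%:E)%E).
    by apply: ereal_inf_lbound; exists r.
  rewrite -[leRHS]mule1 -(@divff _ r) ?lt0r_neq0 // EFinM muleA.
  rewrite lee_pmul2r ?lte_fin ?invr_gt0 //.
  apply: ereal_inf_lbound; exists (p + vec r 0) => /=.
    rewrite quasiD_horizontal ?mxE /= ?addr0 // addrAC subrr add0r.
    exact: ler_norm.
  rewrite quasiD_horizontal !fE !vecE !mxE /= addr0 // -EFinM; congr (_%:E).
  by rewrite (_ : _ - _ = a * r) ?normrM ?(gtr0_norm r0) //; ring.
move=> e e0.
have : (upper_dilatation D D f p < (`|a| + e)%:E)%E.
  by rewrite ul (le_lt_trans lower) // lte_fin ltrDl.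
rewrite /upper_dilatation limf_esupE => /ereal_inf_lt[_ [V V0 <-]] supV.
have : nbhs 0^'+ V by [].
rewrite /at_right; move=> /nbhs_ballP[r /= r0 hr].
exists r => // s sr.
have [->|s0] := eqVneq s 0; first by rewrite addr0 subrr !normr0 mulr0.
have ns0 : 0 < `|s| by rewrite normr_gt0.
have Vs : V `|s|.
  by apply: hr => //; rewrite /ball /= sub0r normrN normr_id.
have up : (upper_dist D D f p `|s| <= ((`|a| + e) * `|s|)%:E)%E.
  rewrite EFinM -lee_pdivrMr //.
  apply: le_trans (ltW supV); apply: ereal_sup_ubound; exists `|s| => //.
set dh := h (p 1 0 + s) - h (p 1 0).
(* The point at height difference [s] with offset [xlnx s + v] is still at distance [|s|]. Of
   [v = s] and [v = - s], one gives [a * v] the sign of [dh], so that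
   [|a s| + |dh| <= (|a| + e) |s|]. *)
have bound v : `|v| = `|s| -> `|a * v + dh| <= (`|a| + e) * `|s|.
  move=> vs; rewrite -lee_fin; apply: le_trans up.
  apply: (@le_trans _ _ (D (f p) (f (p + vec (xlnx s + v) s)))%:E).
    rewrite lee_fin; apply: le_trans (quasiD_dx _ _).
    rewrite !fE !vecE !mxE /=.
    rewrite (_ : a * (p 1 0 + s) + b - _ = a * s); last by ring.
    rewrite xlnxM // le_eqVlt; apply/orP; left; apply/eqP; congr `|_|.
    by rewrite /dh /h; ring.
  apply: ereal_sup_ubound; exists (p + vec (xlnx s + v) s) => //=.
  rewrite quasiD_le !mxE /= [p 1 0 + s]addrC addrK lexx /=.
  by rewrite (_ : _ - _ - _ = v) ?vs //; ring.
have b1 := bound s erefl; have b2 := bound (- s) (normrN s).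
rewrite mulrDl -normrM in b1 b2; rewrite mulrN in b2.
move: b1 b2; set u := a * s; set k := e * `|s|.
by case: (ger0P u) => ?; rewrite !ler_norml; lra.
Unshelve. all: by end_near.
Qed.
End ConformalPoints.

(** * The group G_A and its distance *)

Section Flow.
Context {R : realType}.
Implicit Types (s t x y : R) (v w : 'cV[R]_2) (p q X Y : 'cV[R]_2 * R).

(** The closed form of [e^(tA) v], as [expmx_flow] confirms. *)
Definition flow t v : 'cV[R]_2 :=
  vec (expR t * (v 0 0 + t * v 1 0)) (expR t * v 1 0).

Let nilp : 'M[R]_2 := matA - 1.

Let nilp_sqr : nilp * nilp = 0.
Proof.
apply/matrixP => i j; rewrite !mxE big_ord_recl big_ord1 !mxE.
by case: i => [[|[|//]] ?]; case: j => [[|[|//]] ?] /=; ring.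
Qed.

Let matA_exp k : (matA : 'M[R]_2) ^+ k = 1 + k%:R *: nilp.
Proof.
elim: k => [|k IH]; first by rewrite expr0 scale0r addr0.
rewrite exprS IH (_ : matA = 1 + nilp); last by rewrite /nilp addrC subrK.
rewrite mulrDl mul1r mulrDr mulr1 -scalerAr nilp_sqr scaler0 addr0 -addrA.
by rewrite -[X in _ + (_ + X)]scale1r -scalerDl natr1.
Qed.

(** With [A = 1 + N] and [N^2 = 0], [A^k = 1 + k N]. Since [k t^k / k! = t t^(k-1) / (k-1)!], the
    coefficient of [N] is [t] times an exponential sum with one term fewer. *)
Let expmx_series t n : series (fun k =>
  (k`!%:R)^-1 *: (t *: (matA : 'M[R]_2)) ^+ k) n.+1 =
  series (exp_coeff t) n.+1 *: 1 + (t * series (exp_coeff t) n) *: nilp.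
Proof.
elim: n => [|n IH].
  rewrite !seriesEord /= !big_ord1 big_ord0 mulr0 scale0r addr0 expr0.
  by rewrite /exp_coeff /= expr0 fact0 invr1 mulr1.
rewrite seriesSr IH [in RHS]seriesSr scalerDl.
rewrite [series (exp_coeff t) n.+1 in X in _ = _ + X]seriesSr mulrDr [in
  RHS]scalerDl.
rewrite addrACA; congr (_ + _).
rewrite exprZn matA_exp scalerA scalerDr scalerA; congr (_ *: _ + _ *: _).
  by rewrite /exp_coeff /= mulrC.
rewrite /exp_coeff /= factS natrM exprS.
have n0 : n`!%:R != 0 :> R by rewrite pnatr_eq0 -lt0n fact_gt0.
have n1 : n.+1%:R != 0 :> R by rewrite pnatr_eq0.
  by field; rewrite n0 nat1r n1.
Qed.

Lemma expmx_matA t : expmx (t *: (matA : 'M[R]_2)) = expR t *: 1 + (t * expR t)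
  *: nilp.
Proof.
apply/cvg_lim => //; rewrite -cvg_shiftS.
rewrite (_ : (fun n => _) = (fun n =>
  series (exp_coeff t) n.+1 *: (1 : 'M[R]_2) + (t * series (exp_coeff t) n) *:
    nilp)); last first.
  by apply/funext => n; exact: expmx_series.
have cv : series (exp_coeff t) @ \oo --> expR t by exact:
  is_cvg_series_exp_coeff.
apply: cvgD; apply: cvgZr_tmp.
  by rewrite (cvg_shiftS (series (exp_coeff t))).
by apply: cvgM => //; exact: cvg_cst.
Qed.

Lemma expmx_flow t v : expmx (t *: matA) *m v = flow t v.
Proof.
rewrite expmx_matA; apply: vecP; rewrite !mxE big_ord_recl big_ord1 !mxE /=.
  by rewrite (_ : lift ord0 ord0 = 1) //; [ring|apply/val_inj].
by rewrite (_ : lift ord0 ord0 = 1) //; [ring|apply/val_inj].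
Qed.

End Flow.

Section Metric.
Context {R : realType}.
Local Notation G := ('cV[R]_2 * R)%type.
Implicit Types (s t x y : R) (v w : 'cV[R]_2) (p q X Y : G) (c : R -> G).

Lemma eq_pair p q : p.1 = q.1 -> p.2 = q.2 -> p = q.
Proof. by case: p q => [? ?] [? ?] /= -> ->. Qed.

Lemma flowD s t v : flow s (flow t v) = flow (s + t) v.
Proof. by apply: vecP; rewrite /flow !vecE expRD; ring. Qed.

Lemma flow0 v : flow 0 v = v.
Proof. by apply: vecP; rewrite /flow !vecE expR0; ring. Qed.

Lemma flow_linear t (a : R) v w : flow t (a *: v + w) = a *: flow t v + flow t
  w.
Proof. by apply: vecP; rewrite /flow !mxE /= ?mxE; ring. Qed.

Lemma flowZ t (a : R) v : flow t (a *: v) = a *: flow t v.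
Proof. by apply: vecP; rewrite /flow !mxE /= ?mxE; ring. Qed.

Lemma flowB t v w : flow t (v - w) = flow t v - flow t w.
Proof. by rewrite -scaleN1r addrC flow_linear scaleN1r addrC. Qed.

Lemma gmul_ginvE p q : gmul (ginv p) q =
  (- flow (- p.2) p.1 + flow (- p.2) q.1, - p.2 + q.2).
Proof. by rewrite /gmul /ginv /= !expmx_flow. Qed.

(** Left translation is affine in these coordinates, so its difference quotients are constant. *)
Lemma derive_gmul_ginv p X : 'D_X (gmul (ginv p)) p = (flow (- p.2) X.1, X.2).
Proof.
apply/lim_near_cst => //; near=> h.
have h0 : h != 0 by near: h; exact: nbhs_dnbhs_neq.
rewrite /= !gmul_ginvE /=.
apply: eq_pair => /=.
  rewrite flow_linear opprD opprK addrACA addNr add0r addrK scalerA.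
  by rewrite mulVf // scale1r.
rewrite (_ : _ - _ = h * X.2); last by rewrite /= -[h *: _]/(h * X.2); ring.
by rewrite -[_ *: _]/(h^-1 * (h * X.2)) mulrA mulVf // mul1r.
Unshelve. all: by end_near.
Qed.

Definition speed2 p X : R :=
  (flow (- p.2) X.1) 0 0 ^+ 2 + (flow (- p.2) X.1) 1 0 ^+ 2 + X.2 ^+ 2.

Lemma gmetricE p X : gmetric p X X = speed2 p X.
Proof.
rewrite /gmetric derive_gmul_ginv /euclid_dot big_ord_recl big_ord1 /=.
by rewrite (_ : lift ord0 ord0 = 1) ?expr2 //; apply/val_inj.
Qed.

Lemma speed2Z p (k : R) X : speed2 p (k *: X) = k ^+ 2 * speed2 p X.
Proof.
rewrite /speed2 /= flowZ !mxE /= -[k *: X.2]/(k * X.2); ring.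
Qed.

Definition speed c t : R := Num.sqrt (speed2 (c t) (c^`()%classic t)).

Lemma curve_lengthE c : curve_length c = \int[lebesgue_measure]_(t in `[0,
  1]) speed c t.
Proof. by apply: eq_Rintegral => t _; rewrite gmetricE. Qed.

Lemma cvg_coord {T} (F : set_system T) {FF : Filter F} (u : T -> G) X i :
  u @ F --> X -> (u x).1 i 0 @[x --> F] --> X.1 i 0.
Proof.
move=> uX.
have cont : {for X, continuous (fun p : G => p.1 i 0)}.
  apply: (@continuous_comp _ _ _ (@fst _ _) (fun v : 'cV[R]_2 => v i 0)).
    exact: cvg_fst.
  exact: coord_continuous.
exact: (cvg_comp _ _ uX cont).
Qed.

Lemma cvg_height {T} (F : set_system T) {FF : Filter F} (u : T -> G) X :
  u @ F --> X -> (u x).2 @[x --> F] --> X.2.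
Proof. move=> uX; have cont : {for X,
  continuous (@snd 'cV[R]_2 R)} by exact: cvg_snd.
exact: (cvg_comp _ _ uX cont). Qed.

Lemma cvg_vec {T} (F : set_system T) {FF : Filter F} (u v : T -> R) x y :
  u @ F --> x -> v @ F --> y -> vec (u z) (v z) @[z --> F] --> vec x y.
Proof.
move=> ux vy.
have e a b : vec a b = a *: vec 1 0 + b *: vec 0 1 :> 'cV[R]_2.
  by apply: vecP; rewrite !mxE /=; ring.
rewrite e (_ : (fun z => _) = (fun z => u z *: vec 1 0 + v z *: vec 0 1));
  last first.
  by apply/funext => z; exact: e.
by apply: cvgD; apply: cvgZr_tmp.
Qed.

Lemma cvg_flow {T} (F : set_system T) {FF : Filter F} (u : T -> R) (v : T ->
  G) t X :
  u @ F --> t -> v @ F --> X -> flow (u z) (v z).1 @[z --> F] --> flow t X.1.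
Proof.
move=> ut vX; have e : expR (u z) @[z --> F] --> expR t.
  by apply: (cvg_comp _ _ ut); exact: continuous_expR.
apply: cvg_vec; apply: cvgM => //; last exact: cvg_coord.
by apply: cvgD; [|apply: cvgM => //]; exact: cvg_coord.
Qed.

Lemma cvg_sum_sqr {T} (F : set_system T) {FF : Filter F} (f g h : T ->
  R) (x y z : R) :
  f @ F --> x -> g @ F --> y -> h @ F --> z ->
  f t ^+ 2 + g t ^+ 2 + h t ^+ 2 @[t --> F] --> x ^+ 2 + y ^+ 2 + z ^+ 2.
Proof.
have sqr (k : T -> R) (a : R) : k @ F --> a -> k t ^+ 2 @[t --> F] --> a ^+ 2.
  by move=> ka; rewrite expr2; exact: cvgM.
by move=> fx gy hz; apply: cvgD; [apply: cvgD|]; exact: sqr.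
Qed.

Lemma C1_continuous c : C1_curve c -> continuous c.
Proof.
by move=> [dc _] t; apply: differentiable_continuous; apply/derivable1_diffP.
Qed.

Lemma speed_continuous c : C1_curve c -> continuous (speed c).
Proof.
move=> C1c t; have cc := C1_continuous C1c; have [_ dc] := C1c.
apply: (cvg_comp (fun t => speed2 (c t) (c^`()%classic t)) Num.sqrt);
  last exact: sqrt_continuous.
have fl i : (flow (- (c z).2) (c^`()%classic z).1) i 0 @[z --> t] -->
     (flow (- (c t).2) (c^`()%classic t).1) i 0.
  apply: (cvg_comp (fun z =>
    flow (- (c z).2) (c^`()%classic z).1) (fun v : 'cV[R]_2 => v i 0)).
    apply: cvg_flow; last exact: dc.
    by apply: cvgN; apply: cvg_height; exact: cc.
  exact: coord_continuous.
have ht : (c^`()%classic z).2 @[z --> t] --> (c^`()%classic t).2.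
  by apply: cvg_height; exact: dc.
exact: (cvg_sum_sqr (fl 0) (fl 1) ht).
Qed.

Lemma curve_length_ge0 c : 0 <= curve_length c.
Proof. by apply: Rintegral_ge0 => t _; exact: sqrtr_ge0. Qed.

End Metric.

Section Isometries.
Context {R : realType}.
Local Notation G := ('cV[R]_2 * R)%type.
Implicit Types (s t x y : R) (v w : 'cV[R]_2) (p q X Y : G) (c : R -> G).

(** For [eps = 1] this is left translation by [(w, s)]; for [eps = -1] it is preceded by the group
    automorphism [(v, t) |-> (-v, t)]. *)
Definition similarity_ext (eps s : R) w p : G := (eps *: flow s p.1 + w,
  p.2 + s).

Section OneIsometry.
Context (eps : R) (eps2 : eps ^+ 2 = 1) (s : R) (w : 'cV[R]_2).
Let phi := similarity_ext eps s w.
Let L X : G := (eps *: flow s X.1, X.2).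

Let phiB p q : phi p - phi q = L (p - q).
Proof.
apply: eq_pair; rewrite /= opprD addrACA subrr addr0 //.
by rewrite -scalerBr -flowB.
Qed.

Let LZ (k : R) X : k *: L X = L (k *: X).
Proof. by apply: eq_pair => //=; rewrite flowZ !scalerA mulrC. Qed.

Let L_cvg {T} (F : set_system T) {FF : Filter F} (u : T -> G) X :
  u @ F --> X -> L (u z) @[z --> F] --> L X.
Proof.
move=> uX; have h2 : (u z).2 @[z --> F] --> X.2 by exact: cvg_height.
have h1 : eps *: flow s (u z).1 @[z --> F] --> eps *: flow s X.1.
  apply: (@cvgZl_tmp R _ _ F _ eps (fun z => flow s (u z).1)).
  by apply: (cvg_flow (u := fun=> s)) => //; exact: cvg_cst.
exact: cvg_pair h1 h2.
Qed.

Let phi_derive c t : derivable c t 1 ->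
  derivable (phi \o c) t 1 /\ (phi \o c)^`()%classic t = L (c^`()%classic t).
Proof.
move=> dc; have cv : (fun h : R =>
  h^-1 *: ((phi \o c \o shift t) (h *: 1) - (phi \o c) t)) @ 0^' -->
    L (c^`()%classic t).
  rewrite (_ : (fun _ => _) = (fun h : R =>
    L (h^-1 *: ((c \o shift t) (h *: 1) - c t)))); last first.
    by apply/funext => h; rewrite /= phiB LZ.
  by apply: L_cvg; rewrite derive1E.
by split; [apply/cvg_ex; exists (L (c^`()%classic t))|rewrite derive1E;
  exact/cvg_lim].
Qed.

Lemma similarity_ext_C1 c : C1_curve c -> C1_curve (phi \o c).
Proof.
move=> [dc cc]; split=> [t|t]; first exact: (phi_derive (dc t)).1.
rewrite (_ : (phi \o c)^`()%classic = (fun t => L (c^`()%classic t)));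
  last first.
  by apply/funext => u; exact: (phi_derive (dc u)).2.
by apply: L_cvg; exact: cc.
Qed.

(** The change of height by [s] in the base point cancels [flow s] in the differential, and squaring
    removes the sign [eps]. *)
Lemma similarity_ext_length c : C1_curve c ->
  curve_length (phi \o c) = curve_length c.
Proof.
move=> [dc _]; rewrite !curve_lengthE; apply: eq_Rintegral => t _.
rewrite /speed (phi_derive (dc t)).2 /speed2 /phi /L /=; congr Num.sqrt.
by rewrite flowZ flowD opprD subrK !mxE !exprMn eps2 !mul1r.
Qed.

End OneIsometry.

Lemma similarity_ext_inv eps s w : eps ^+ 2 = 1 ->
  cancel (similarity_ext eps s w) (similarity_ext eps (- s) (- (eps *: flow (-
    s) w))).
Proof.
rewrite expr2 => e p; apply: eq_pair;
  rewrite /= ?addrK // [_ + w]addrC -[w]scale1r flow_linear !scale1r.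
by rewrite scalerDr addrAC subrr add0r flowZ flowD addNr flow0 scalerA e
  scale1r.
Qed.

Lemma similarity_ext_invr eps s w : eps ^+ 2 = 1 ->
  cancel (similarity_ext eps (- s) (- (eps *: flow (- s) w))) (similarity_ext
    eps s w).
Proof.
move=> e p; apply: eq_pair; rewrite /= ?subrK //; move: e; rewrite expr2 => e.
by rewrite -scalerBr -flowB flowZ scalerA e scale1r flowD addrN flow0 subrK.
Qed.

Lemma similarity_ext_gdist_le eps s w p q : eps ^+ 2 = 1 ->
  [set curve_length c | c in [set c | [/\ C1_curve c, c 0 = p & c 1 = q]]] `<=`
  [set curve_length c | c in [set c | [/\ C1_curve c,
    c 0 = similarity_ext eps s w p & c 1 = similarity_ext eps s w q]]].
Proof.
move=> e _ [c [Cc c0 c1] <-]; exists (similarity_ext eps s w \o c);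
  last exact: similarity_ext_length.
by split; [exact: similarity_ext_C1|rewrite /= c0|rewrite /= c1].
Qed.

Lemma similarity_ext_isometry eps s w : eps ^+ 2 = 1 ->
  is_isometry (similarity_ext eps s w).
Proof.
move=> e; split.
  exists (similarity_ext eps (- s) (- (eps *: flow (- s) w))).
    exact: similarity_ext_inv.
  exact: similarity_ext_invr.
(* The sets of curve lengths coincide: the second inclusion is the first one for the inverse, which
   has the same form. *)
move=> p q; congr inf; apply/seteqP; split; last exact: similarity_ext_gdist_le.
have := @similarity_ext_gdist_le eps (- s) (- (eps *: flow (- s) w))
  (similarity_ext eps s w p)
  (similarity_ext eps s w q) e.
by rewrite !similarity_ext_inv.
Qed.

Definition segment p X : R -> G := fun t => p + t *: X.

Lemma segment_derive p X t : is_derive t 1 (segment p X) X.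
Proof.
have cv : (fun h : R =>
  h^-1 *: ((segment p X \o shift t) (h *: 1) - segment p X t)) @ 0^' --> X.
  apply: cvg_near_cst; near=> h.
  have h0 : h != 0 by near: h; exact: nbhs_dnbhs_neq.
  rewrite /segment /= opprD addrACA subrr add0r -scalerBl addrK scalerA.
  by rewrite -[h *: 1]/(h * 1) mulr1 mulVf // scale1r.
by apply: DeriveDef; [apply/cvg_ex; exists X|exact/cvg_lim].
Unshelve. all: by end_near.
Qed.

Lemma segment_C1 p X : C1_curve (segment p X).
Proof.
have dE t : (segment p X)^`()%classic t = X.
  by rewrite derive1E; have [_ ->] := segment_derive p X t.
split=> [t|t]; first by have [] := segment_derive p X t.
rewrite (_ : (segment p X)^`()%classic = cst X); first exact: cvg_cst.
exact/funext.
Qed.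

Lemma gdist_le_length c p q : C1_curve c -> c 0 = p -> c 1 = q ->
  gdist p q <= curve_length c.
Proof.
move=> Cc c0 c1; apply: inf_lbound; last by exists c.
by exists 0 => _ [k _ <-]; exact: curve_length_ge0.
Qed.

Lemma curve_length_integrable c : C1_curve c ->
  (@lebesgue_measure R).-integrable `[0, 1] (EFin \o speed c).
Proof.
move=> Cc; apply: continuous_compact_integrable; first exact: segment_compact.
by apply: continuous_subspaceT; exact: speed_continuous.
Qed.

Lemma gdist_segment p X (M : R) :
  (forall t, 0 <= t <= 1 -> speed2 (segment p X t) X <= M ^+ 2) -> 0 <= M ->
  gdist p (p + X) <= M.
Proof.
move=> le M0; have Cc := segment_C1 p X.
apply: (@le_trans _ _ (curve_length (segment p X))).
  by apply: gdist_le_length; rewrite // /segment ?scale0r ?addr0 ?scale1r.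
rewrite curve_lengthE.
have -> : M = \int[lebesgue_measure]_(t in `[0, 1]) M.
  have m01 : fine (@lebesgue_measure R `[0, 1]%classic) = 1.
    by rewrite lebesgue_measure_itv /= lte_fin ltr01 oppr0 adde0.
  by rewrite Rintegral_cst // -[LHS]mulr1; congr (_ * _); exact: esym.
apply: le_Rintegral => //.
- exact: curve_length_integrable.
- apply: continuous_compact_integrable; first exact: segment_compact.
  by apply: continuous_subspaceT => ?; exact: cvg_cst.
- move=> t /=; rewrite in_itv /= => t01; rewrite /speed derive1E.
  have [_ ->] := segment_derive p X t.
  by rewrite -[M]ger0_norm // -sqrtr_sqr ler_wsqrtr // le.
Qed.

Lemma gdist_vertical v t s : gdist (v, t) (v, t + s) <= `|s|.
Proof.
have -> : (v, t + s) = (v, t) + (0, s) :> G by apply: eq_pair;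
  rewrite //= addr0.
apply: gdist_segment => // u _;
  rewrite /speed2 /= -(scale0r 0) flowZ scale0r !mxE expr0n !add0r /=.
by rewrite -normrX ler_norm.
Qed.

(** The entries of [e^(-kA)] are bounded when [k] is bounded below, since [k e^(-k) <= 1] for
    [k >= 0]. Straight segments with a fixed displacement therefore have bounded length at all
    heights above [- T], which is what asymptoticity towards [xi0] requires. *)
Lemma gdist_asymptotic (T : R) w s : exists M, forall v t, - T <= t ->
  gdist (v, t) (v + w, t + s) <= M.
Proof.
pose r := `|s| + `|T|; have r0 : 0 <= r by rewrite addr_ge0.
pose E := expR r; pose m := E * (`|w 0 0| + (1 + r) * `|w 1 0|).
have E1 : 1 <= E by rewrite /E -[leLHS]expR0 ler_expR.
have m0 : 0 <= m.
  by rewrite /m mulr_ge0 ?addr_ge0 ?mulr_ge0 ?addr_ge0 //; apply: le_trans E1.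
exists (m + m + `|s|) => v t t0.
rewrite (_ : (v + w, t + s) = (v, t) + (w, s)) //.
apply: gdist_segment; last by rewrite !addr_ge0.
move=> u /andP[u0 u1].
pose k := t + u * s; have ks : - k <= r.
  have : - (u * s) <= `|s|.
    by rewrite (le_trans (ler_norm _)) // normrN normrM ger0_norm // ler_piMl.
  by have := ler_norm T; rewrite /k /r; lra.
have e1 : expR (- k) <= E by rewrite ler_expR.
have e0 : 0 < expR (- k) by exact: expR_gt0.
have e2 : expR (- k) * `|k| <= E * (1 + r).
  have [k0|k0] := leP 0 k.
    have : expR (- k) * k <= 1.
      rewrite expRN mulrC ler_pdivrMr ?expR_gt0 // mul1r.
      by apply: le_trans (expR_ge1Dx _); lra.
    have : 0 <= E * r by rewrite mulr_ge0 //; lra.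
    rewrite (ger0_norm k0) (_ : E * (1 + r) = E + E * r); last by ring.
    by lra.
  apply: ler_pM; rewrite ?(ltW e0) // ltr0_norm //; lra.
have f0 : `|(flow (- k) w) 0 0| <= m.
  rewrite vecE normrM (gtr0_norm e0) /m mulrDr.
  apply: (@le_trans _ _ (expR (- k) * `|w 0 0| + expR (- k) * `|k| * `|w 1 0|)).
    by rewrite -mulrA -mulrDr ler_wpM2l ?(ltW e0) // (le_trans (ler_normD _ _))
      // normrM normrN.
  by rewrite mulrA lerD // ler_wpM2r.
have f1 : `|(flow (- k) w) 1 0| <= m.
  rewrite vecE normrM (gtr0_norm e0) /m.
  apply: ler_pM; rewrite ?(ltW e0) // mulrDl mul1r.
  have : 0 <= r * `|w 1 0| by rewrite mulr_ge0.
  have := normr_ge0 (w 0 0); lra.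
rewrite /speed2 (_ : (segment (v, t) (w, s) u).2 = k) //=.
have sq (a b : R) : `|a| <= b -> a ^+ 2 <= b ^+ 2.
  by move=> ab;
    rewrite -real_normK ?num_real // ler_pXn2r // nnegrE (le_trans _ ab).
have := sq _ _ f0; have := sq _ _ f1; have := sq s _ (lexx `|s|).
have ns := normr_ge0 s.
have := mulr_ge0 m0 m0; have := mulr_ge0 m0 ns.
rewrite !expr2; nra.
Qed.

End Isometries.

(** * The triangle inequality for [gdist], by concatenation of C1 curves *)

Section Triangle.
Context {R : realType}.
Local Notation G := ('cV[R]_2 * R)%type.
Implicit Types (s t x y : R) (p q X Y : G) (c : R -> G).
Local Notation mu := (@lebesgue_measure R).

(** The square of the positive part: a C1 function that vanishes on the negative half-line. *)
Definition sqr_pos x : R := x * Num.max x 0.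

Lemma is_derive_sqr_pos x : is_derive x 1 sqr_pos (2 * Num.max x 0).
Proof.
have cv : (fun h : R =>
  h^-1 *: ((sqr_pos \o shift x) (h *: 1) - sqr_pos x)) @ 0^' -->
    2 * Num.max x 0.
  apply/cvgrPdist_le => e e0; near=> h.
  have h0 : h != 0 by near: h; exact: nbhs_dnbhs_neq.
  have he : `|h| <= e by near: h; exact: dnbhs0_le.
  apply: le_trans he; rewrite /= -[h *: 1]/(h * 1) mulr1.
  rewrite -[_ *: _]/(h^-1 * (sqr_pos (h + x) - sqr_pos x)).
  have nh : 0 < `|h| by rewrite normr_gt0.
  rewrite -(ler_pM2l nh) -[X in X <= _]normrM -expr2 real_normK ?num_real //
    mulrBr mulVKf //.
  rewrite /sqr_pos ler_norml.
  by case: (leP x 0) => ?; case: (leP (h + x) 0) => ?; nra.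
by apply: DeriveDef; [apply/cvg_ex; eexists; exact: cv|exact/cvg_lim].
Unshelve. all: by end_near.
Qed.

(* Both derivatives vanish at [1/2], so two curves concatenated along these
   reparametrizations form a C1 curve without any smoothing. *)
Definition first_half t : R := 1 - 4 * sqr_pos (2^-1 - t).
Definition last_half t : R := 4 * sqr_pos (t - 2^-1).

Lemma first_half_derive t : is_derive t 1 first_half (8 * Num.max (2^-1 - t) 0).
Proof.
have h1 : is_derive t 1 (fun t : R => 2^-1 - t) (-1).
  have h := is_deriveB (is_derive_cst (2^-1 : R) t 1) (is_derive_id t (1 : R)).
  by rewrite sub0r in h; exact: h.
have h2 := is_derive_sqr_pos (2^-1 - t).
rewrite /first_half.
have h3 := @is_derive1_comp R sqr_pos (fun t : R => 2^-1 - t) t _ _ h2 h1.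
have h4 := is_deriveB (is_derive_cst (1 : R) t 1) (is_deriveZ 4 h3).
apply: (is_derive_eq h4).
rewrite sub0r -[_ *: _]/(4 * (2 * Num.max (2^-1 - t) 0 * -1)); ring.
Qed.

Lemma last_half_derive t : is_derive t 1 last_half (8 * Num.max (t - 2^-1) 0).
Proof.
have h1 : is_derive t 1 (fun t : R => t - 2^-1) 1.
  have h := is_deriveB (is_derive_id t (1 : R)) (is_derive_cst (2^-1 : R) t 1).
  by rewrite subr0 in h; exact: h.
have h2 := is_derive_sqr_pos (t - 2^-1).
have h3 := @is_derive1_comp R sqr_pos (fun t : R => t - 2^-1) t _ _ h2 h1.
apply: (is_derive_eq (is_deriveZ 4 h3)).
rewrite -[_ *: _]/(4 * (2 * Num.max (t - 2^-1) 0 * 1)); ring.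
Qed.


Lemma first_half_right t : 2^-1 <= t -> first_half t = 1.
Proof. by move=> ht;
  rewrite /first_half /sqr_pos (max_idPr _) ?mulr0 ?subr0 //; lra. Qed.

Lemma last_half_left t : t <= 2^-1 -> last_half t = 0.
Proof. by move=> ht; rewrite /last_half /sqr_pos (max_idPr _) ?mulr0 //; lra.
  Qed.

Lemma first_half0 : first_half 0 = 0.
Proof. by rewrite /first_half /sqr_pos (max_idPl _); lra. Qed.

Lemma last_half1 : last_half 1 = 1.
Proof. by rewrite /last_half /sqr_pos (max_idPl _); lra. Qed.

Lemma first_half_incr : {in `[0, 2^-1] &, {homo first_half : x y / x < y}}.
Proof.
move=> x y; rewrite !in_itv /= /first_half /sqr_pos =>
  /andP[x0 x2] /andP[y0 y2] xy.
have xs : 0 <= 2^-1 - x by lra.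
have ys : 0 <= 2^-1 - y by lra.
have : (2^-1 - y) ^+ 2 < (2^-1 - x) ^+ 2 by rewrite ltr_pXn2r ?nnegrE //; lra.
by rewrite (max_idPl xs) (max_idPl ys) !expr2; lra.
Qed.

Lemma last_half_incr : {in `[2^-1, 1] &, {homo last_half : x y / x < y}}.
Proof.
move=> x y; rewrite !in_itv /= /last_half /sqr_pos =>
  /andP[x0 x2] /andP[y0 y2] xy.
have xs : 0 <= x - 2^-1 by lra.
have ys : 0 <= y - 2^-1 by lra.
have : (x - 2^-1) ^+ 2 < (y - 2^-1) ^+ 2 by rewrite ltr_pXn2r ?nnegrE //; lra.
by rewrite (max_idPl xs) (max_idPl ys) !expr2; lra.
Qed.

Lemma is_derive_reparam c (al : R -> R) t (a : R) :
  (forall t, derivable c t 1) -> is_derive t 1 al a ->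
  is_derive t 1 (c \o al) (a *: c^`()%classic (al t)).
Proof.
move=> dc [dal <-].
have dal' : differentiable al t by apply/derivable1_diffP.
have dc' : differentiable c (al t) by apply/derivable1_diffP.
have dcomp : differentiable (c \o al) t by exact: differentiable_comp.
apply: DeriveDef; first exact/derivable1_diffP.
by rewrite (deriveE _ dcomp) diff_comp //= (diff1E dc') (deriveE _ dal').
Qed.

(** On each half of [[0, 1]] one of the two terms is constantly [q] and cancels. The sum replaces a
    definition by cases and can be differentiated term by term. *)
Definition concat c1 c2 q t : G := c1 (first_half t) + c2 (last_half t) - q.

Section Concat.
Context (c1 c2 : R -> G) (q : G).
Context (C1 : C1_curve c1) (C2 : C1_curve c2) (c1q : c1 1 = q) (c2q : c2 0 = q).
Let c := concat c1 c2 q.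

Let concat_derive t : is_derive t 1 c
  ((8 * Num.max (2^-1 - t) 0) *: c1^`()%classic (first_half t) +
   (8 * Num.max (t - 2^-1) 0) *: c2^`()%classic (last_half t)).
Proof.
have d1 := is_derive_reparam C1.1 (first_half_derive t).
have d2 := is_derive_reparam C2.1 (last_half_derive t).
have d3 := is_deriveB (is_deriveD d1 d2) (is_derive_cst q t 1).
by rewrite subr0 in d3; exact: d3.
Qed.

Let concat_derive1 t : c^`()%classic t =
  (8 * Num.max (2^-1 - t) 0) *: c1^`()%classic (first_half t) +
   (8 * Num.max (t - 2^-1) 0) *: c2^`()%classic (last_half t).
Proof. by rewrite derive1E; have [_ ->] := concat_derive t. Qed.

Let first_half_continuous : continuous first_half.
Proof.
move=> t; apply: differentiable_continuous; apply/derivable1_diffP.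
by have [] := first_half_derive t.
Qed.

Let last_half_continuous : continuous last_half.
Proof.
move=> t; apply: differentiable_continuous; apply/derivable1_diffP.
by have [] := last_half_derive t.
Qed.

Let max0_continuous (k : R -> R) : continuous k -> continuous (fun t =>
  8 * Num.max (k t) 0).
Proof.
move=> kc t; apply: cvgM; first exact: cvg_cst.
by apply: continuous_max; [exact: kc|exact: cvg_cst].
Qed.

Let der1_continuous : continuous (fun t : R => 8 * Num.max (2^-1 - t) 0).
Proof. by apply: max0_continuous => t; apply: cvgB;
  [exact: cvg_cst|exact: cvg_id]. Qed.

Let der2_continuous : continuous (fun t : R => 8 * Num.max (t - 2^-1) 0).
Proof. by apply: max0_continuous => t; apply: cvgB;
  [exact: cvg_id|exact: cvg_cst]. Qed.

Lemma concat_C1 : C1_curve c.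
Proof.
split=> [t|t]; first by have [] := concat_derive t.
rewrite (_ : c^`()%classic = fun t =>
  (8 * Num.max (2^-1 - t) 0) *: c1^`()%classic (first_half t) +
   (8 * Num.max (t - 2^-1) 0) *: c2^`()%classic (last_half t));
     last exact/funext/concat_derive1.
have h1 : {for t, continuous (c1^`()%classic \o first_half)}.
  by apply: continuous_comp; [exact: first_half_continuous|exact: C1.2].
have h2 : {for t, continuous (c2^`()%classic \o last_half)}.
  by apply: continuous_comp; [exact: last_half_continuous|exact: C2.2].
apply: cvgD; apply: cvgZ;
  [exact: der1_continuous|exact: h1|exact: der2_continuous|exact: h2].
Qed.

Lemma concat0 : c 0 = c1 0.
Proof. by rewrite /c /concat first_half0 last_half_left ?c2q ?addrK. Qed.

Lemma concat1 : c 1 = c2 1.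
Proof.
by rewrite /c /concat last_half1 first_half_right ?c1q;
  [rewrite addrAC subrr add0r|lra].
Qed.

Let speed_first t : t <= 2^-1 ->
  speed c t = speed c1 (first_half t) * (8 * Num.max (2^-1 - t) 0).
Proof.
move=> t2; rewrite /speed concat_derive1 (max_idPr (_ : t - 2^-1 <= 0));
  last lra.
rewrite mulr0 scale0r addr0 /c /concat last_half_left // c2q addrK speed2Z.
rewrite sqrtrM ?sqr_ge0 // sqrtr_sqr ger0_norm; first by rewrite mulrC.
by rewrite mulr_ge0 // le_max lexx orbT.
Qed.

Let speed_last t : 2^-1 <= t ->
  speed c t = speed c2 (last_half t) * (8 * Num.max (t - 2^-1) 0).
Proof.
move=> t2; rewrite /speed concat_derive1 (max_idPr (_ : 2^-1 - t <= 0));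
  last lra.
rewrite mulr0 scale0r add0r /c /concat first_half_right // c1q addrAC subrr
  add0r speed2Z.
rewrite sqrtrM ?sqr_ge0 // sqrtr_sqr ger0_norm; first by rewrite mulrC.
by rewrite mulr_ge0 // le_max lexx orbT.
Qed.

Let substitution (al dal : R -> R) (a b : R) (g : R -> R) : a <= b ->
  {in `[a, b] &, {homo al : x y / x < y}} -> (forall t,
    is_derive t 1 al (dal t)) ->
  continuous dal -> continuous g -> al a = 0 -> al b = 1 ->
  \int[mu]_(t in `[a, b]) (g (al t) * dal t) = \int[mu]_(t in `[0, 1]) g t.
Proof.
move=> ab incr dal_ dc gc a0 b1.
have alE : al^`()%classic = dal.
  by apply/funext => t; rewrite derive1E; have [_ ->] := dal_ t.
have alc : continuous al.
  move=> t; apply: differentiable_continuous; apply/derivable1_diffP.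
  by have [] := dal_ t.
rewrite /Rintegral -a0 -b1 integration_by_substitution_increasing // ?alE //.
- by apply/cvg_ex; exists (dal a); apply: cvg_at_right_filter; exact: dc.
- by apply/cvg_ex; exists (dal b); apply: cvg_at_left_filter; exact: dc.
- split; first by move=> t _; have [] := dal_ t.
    by apply: cvg_at_right_filter; exact: alc.
  by apply: cvg_at_left_filter; exact: alc.
- exact: continuous_subspaceT.
Qed.

Lemma concat_length : curve_length c = curve_length c1 + curve_length c2.
Proof.
have int := curve_length_integrable concat_C1.
have e : (2^-1 : R) <= 1 by lra.
have e' : (0 : R) <= 2^-1 by lra.
have lo : (BLeft (0 : R) <= BRight (2^-1 : R))%O by rewrite bnd_simp.
have hi : (BRight (2^-1 : R) <= BRight (1 : R))%O by rewrite bnd_simp.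
have int' : mu.-integrable `]2^-1, 1] (EFin \o speed c).
  have sub : `]2^-1, 1]%classic `<=` `[(0 : R), 1]%classic.
    by move=> x; rewrite /= !in_itv /= => /andP[x0 x1]; rewrite x1 andbT; lra.
  by apply: (@integrableS _ _ _ mu `[0, 1]%classic).
have split_half :=
  etrans (Rintegral_itvB int lo hi) (Rintegral_itv_obnd_cbnd int').
have first : \int[mu]_(t in `[0, 2^-1]) speed c t = \int[mu]_(t in `[0,
  1]) speed c1 t.
  rewrite -(substitution e' _ first_half_derive der1_continuous
    (speed_continuous C1)).
  - by apply: eq_Rintegral => t; rewrite inE /= in_itv /= => /andP[_ t2];
      exact: speed_first.
  - exact: first_half_incr.
  - exact: first_half0.
  - by apply: first_half_right.
have last : \int[mu]_(t in `[2^-1, 1]) speed c t = \int[mu]_(t in `[0,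
  1]) speed c2 t.
  rewrite -(substitution e _ last_half_derive der2_continuous (speed_continuous
    C2)).
  - by apply: eq_Rintegral => t; rewrite inE /= in_itv /= => /andP[t2 _];
      exact: speed_last.
  - exact: last_half_incr.
  - by apply: last_half_left.
  - exact: last_half1.
have sum (x y z : R) : x - y = z -> x = y + z by move=> <-; rewrite addrC subrK.
have {split_half} := sum _ _ _ split_half; move: first last.
move: (\int[mu]_(t in `[0, 2^-1]) speed c t) (\int[mu]_(t in `[2^-1,
  1]) speed c t) => i1 i2 -> ->.
rewrite (curve_lengthE c1) (curve_lengthE c2) (curve_lengthE c).
exact.
Qed.
End Concat.

Lemma gdist_approx p q (e : R) : 0 < e -> exists c,
  [/\ C1_curve c, c 0 = p, c 1 = q & curve_length c < gdist p q + e].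
Proof.
move=> e0; have [|_ [c [Cc cp cq] <-] lt] := @inf_adherent R
    [set curve_length c | c in [set c : R -> G | [/\ C1_curve c, c 0 = p &
      c 1 = q]]] e e0; last by exists c.
split; last by exists 0 => _ [k _ <-]; exact: curve_length_ge0.
exists (curve_length (segment p (q - p))); exists (segment p (q - p)) => //.
split; first exact: segment_C1.
  by rewrite /segment scale0r addr0.
by rewrite /segment scale1r addrC subrK.
Qed.

Lemma gdist_triangle p q z : gdist p z <= gdist p q + gdist q z.
Proof.
apply/ler_addgt0Pr => e e0; have e2 : 0 < e / 2 by rewrite divr_gt0.
have [c1 [C1 c10 c11 l1]] := gdist_approx p q e2.
have [c2 [C2 c20 c21 l2]] := gdist_approx q z e2.
have Cc := concat_C1 q C1 C2.
apply: (@le_trans _ _ (curve_length (concat c1 c2 q))).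
  by apply: gdist_le_length; rewrite ?concat0 ?concat1.
rewrite (concat_length C1 C2 c11 c20).
have := lerD (ltW l1) (ltW l2); rewrite addrACA -splitr.
exact.
Qed.

End Triangle.

(** * Action of the isometries on the ideal boundary *)

Section BoundaryMap.
Context {R : realType}.
Local Notation G := ('cV[R]_2 * R)%type.
Implicit Types (phi psi : G -> G) (c : R -> G).

(** A ray asymptotic to [c1] is carried to one asymptotic to [phi \o c1], hence to [c2], and [psi]
    carries such rays back. The bound is assumed in both orders, so that symmetry of [gdist] is not
    invoked. *)
Lemma induced_endpoint phi psi c1 c2 (M : R) : is_isometry phi ->
  cancel phi psi -> cancel psi phi ->
  (forall t, 0 <= t -> gdist (c2 t) (phi (c1 t)) <= M) ->
  (forall t, 0 <= t -> gdist (phi (c1 t)) (c2 t) <= M) ->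
  induced_boundary_map phi (endpoint c1) = endpoint c2.
Proof.
move=> [_ iso] phiK psiK d21 d12; apply/seteqP;
  split=> [_ [c [gc [C hC]] <-]|c [gc [C hC]]].
  split=> [s t s0 t0|]; first by rewrite /= iso gc.
  exists (M + C) => t t0; apply: (le_trans (gdist_triangle _ (phi (c1 t)) _)).
  by rewrite lerD ?d21 //= iso hC.
exists (psi \o c); last by apply/funext => t /=; rewrite psiK.
split=> [s t s0 t0|]; first by rewrite -iso /= !psiK gc.
exists (M + C) => t t0; rewrite -iso /= psiK.
by apply: (le_trans (gdist_triangle _ (c2 t) _)); rewrite lerD ?d12 ?hC.
Qed.

Lemma similarity_boundary_map eps (s : R) w : eps ^+ 2 = 1 ->
  boundary_map_of (similarity_ext eps s w) (fun v => eps *: flow s v + w).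
Proof.
move=> e.
have iso := similarity_ext_isometry s w e.
have K : cancel _ _ := similarity_ext_inv s w e.
have K' : cancel _ _ := similarity_ext_invr s w e.
have f0 : flow s 0 = 0 :> 'cV[R]_2 by apply: vecP; rewrite /flow !mxE /= ?mxE;
  ring.
split=> [|v].
  (* [M2] serves the reverse displacement, from [(w, t + s)] back to [(0, t)]; its base height is at
     least [s], hence the threshold [- s]. *)
  have [M1 h1] := gdist_asymptotic 0 w s; have [M2 h2] :=
    gdist_asymptotic (- s) (- w) (- s).
  apply: (induced_endpoint (M := Num.max M1 M2) iso K K') => t t0.
    rewrite /similarity_ext /vertical /= f0 scaler0 le_max; apply/orP; left.
    by apply: h1; rewrite oppr0.
  rewrite /similarity_ext /vertical /= f0 scaler0 le_max; apply/orP; right.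
  have := h2 (0 + w) (t + s); rewrite !addrK; apply; rewrite opprK.
  by rewrite lerDr.
apply: (induced_endpoint (M := `|s|) iso K K') => t t0.
  exact: gdist_vertical.
rewrite /similarity_ext /vertical /=.
have := gdist_vertical (eps *: flow s v + w) (- t + s) (- s).
by rewrite addrK normrN.
Qed.

End BoundaryMap.

Theorem theorem1p2 (R : realType) (f : 'cV[R]_2 -> 'cV[R]_2)
    (hf : conformal quasimetricD quasimetricD f) :
  exists phi : 'cV[R]_2 * R -> 'cV[R]_2 * R,
    is_isometry phi /\ boundary_map_of phi f.
Proof.
have [g [fg gf qs ae _]] := hf.
have control := quasisymmetric_control qs.
have [B B0 hB] := control.1 1.
have [|p q z pqz|a [b [C [a0 fE [K lip]]]]] :=
  @rigid_form R f g fg gf control (B + 1).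
- by rewrite lerDr ltW.
- apply: (@le_trans _ _ (B * quasimetricD (f p) (f z))); first by apply: hB;
    rewrite mul1r.
  by rewrite ler_wpM2r ?quasiD_ge0 // lerDl.
have hc := lipschitz_flat_const (h := fun y =>
  C y - a * ln `|a| * y) hausdorff_dim_plane ae lip.
have CE y : C y = a * ln `|a| * y + C 0.
  have : C y - a * ln `|a| * y = C 0 - a * ln `|a| * 0; last by lra.
  apply: hc => x t /contrapT cf; rewrite -[t](vec1 x t).
  exact: conformal_flat fE cf.
have e2 : Num.sg a ^+ 2 = 1 by rewrite sqr_sg a0.
exists (similarity_ext (Num.sg a) (ln `|a|) (vec (C 0) b)); split.
  exact: similarity_ext_isometry.
rewrite (_ : f = fun v => Num.sg a *: flow (ln `|a|) v + vec (C 0) b).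
  exact: similarity_boundary_map.
(* Here [e^(ln|a|) = |a|] and [sgn(a) |a| = a]; the term [a ln|a|] of [C] is the shear of the flow
   at time [ln|a|]. *)
apply/funext => v; rewrite fE; apply: vecP;
  rewrite /flow !mxE /= ?mxE /= lnK ?posrE ?normr_gt0 //.
  by rewrite CE mulrA mulr_sg_norm; ring.
by rewrite mulrA mulr_sg_norm.
Qed.
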